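(* Let $p$ be a prime number and $K$ a $p$-field. Let $E$ be a wildly primitive extension of $K$, $p^n=[E:K]$ its degree, and $\varepsilon(E)$ its differental excess over $K$. Let $M=EL_n$, and let $\gamma(C)$ be the unique ramification break of $C=\mathrm{Gal}(M|L_n)$. Let $D$ be the simple $\mathbf{F}_p[G_n]$-submodule of $L_n^\times/L_n^{\times p}$ (if $K$ has characteristic $0$) or of $L_n^+/\wp(L_n^+)$ (if $K$ has characteristic $p$), of degree $n$ (that is, $\dim_{\mathbf{F}_p}D=n$), such that $M=L_n(\sqrt[p]{D})$, respectively $M=L_n(\wp^{-1}(D))$, and let $\delta(D)$ be its level. Then $\gamma(C)=\delta(D)=\varepsilon(E)$.
   Context: A $p$-field is a local field (complete for a discrete valuation) with finite residue field of characteristic $p$. All extensions of $K$ are assumed separable over $K$ and contained in a fixed maximal galoisian extension (separable closure) $\tilde K$ of $K$. A finite extension $E$ of $K$ is called primitive if $[E:K]>1$ and the only extensions of $K$ contained in $E$ are $K$ and $E$; it is called wildly primitive if it is primitive, its degree is a power of $p$, and it is ramified (it is then wildly and totally ramified over $K$). For $n>0$ put $e_n=p^n-1$, $K_n=K(\sqrt[e_n]{1})$, where $\sqrt[e_n]{1}$ denotes an element of order $e_n$ in the multiplicative group, and $L_n=K_n\bigl(\sqrt[e_n]{K_n^\times}\bigr)$ (the maximal abelian extension of $K_n$ of exponent dividing $e_n$). $L_n$ is a finite tamely ramified galoisian extension of $K$ with ramification index $e_n$; put $G_n=\mathrm{Gal}(L_n|K)$. If $K$ has characteristic $0$, then $L_n$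 contains a primitive $p$-th root of $1$. $L_n^+$ is the additive group of $L_n$ and $\wp(x)=x^p-x$. $L_n(\sqrt[p]{D})$ is obtained by adjoining to $L_n$ all $p$-th roots of all $x\in L_n^\times$ whose class lies in $D$; $L_n(\wp^{-1}(D))$ is obtained by adjoining all $y$ with $\wp(y)\in L_n$ having class in $D$. For every primitive extension $E$ of $K$ of degree $p^n$, the extension $M=EL_n$ of $L_n$ is abelian of exponent $p$ and degree $p^n$, $M$ is galoisian over $K$, the $\mathbf{F}_p[G_n]$-module $C=\mathrm{Gal}(M|L_n)$ is simple, and there is a unique submodule $D$ as in the claim. The ramification filtration (lower numbering) on $C$ has a unique break $\gamma(C)$: the integer $\gamma$ with $C_\gamma=C$ and $C_{\gamma+1}=\{1\}$. Level, characteristic $0$: let $e_{L_n}$ be the ramification index of $L_n$ over $\mathbf{Q}_p$ and $c_n=e_{L_n}/(p-1)$, which is an integer. Let $\mathfrak{p}_{L_n}$ be the maximal ideal of the ring of integers of $L_n$. For $i>0$ let $\bar U_{L_n}^i$ be the image of $1+\mathfrak{p}_{L_n}^i$ in $L_n^\times/L_n^{\times p}$, and put $\bar U_{L_n}^0=L_n^\times/L_n^{\times p}$. There is a unique $i\in\mathbf{N}$ such that $D\subset\bar U_{L_n}^i$ and $D\cap\bar U_{L_n}^{i+1}=\{1\}$; the level of $D$ is $\delta(D)=pc_n-i$. Level, characteristic $p$: for $i\in\mathbf{Z}$ let $\overline{\mathfrak{p}_{L_n}^i}$ be the image of $\mathfrak{p}_{L_n}^i$ in $L_n^+/\wp(L_n^+)$.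 There is a unique $i\in\mathbf{Z}$ such that $D\subset\overline{\mathfrak{p}_{L_n}^i}$ and $D\cap\overline{\mathfrak{p}_{L_n}^{i+1}}=\{0\}$; the level of $D$ is $\delta(D)=-i$. Differental excess: for a finite extension $L$ of $K$ with differental exponent $d_{L|K}$ (the exponent of the different of $L|K$ as a power of the maximal ideal of the ring of integers of $L$) and ramification index $e_{L|K}$, put $\varepsilon(L)=d_{L|K}-(e_{L|K}-1)$. *)

(* Defs.v *)
From HB Require Import structures.
From mathcomp Require Import all_boot all_order all_algebra all_fingroup all_field.

Set Implicit Arguments.
Unset Strict Implicit.
Unset Printing Implicit Defensive.

Import Order.TTheory GRing.Theory Num.Theory.
Local Open Scope ring_scope.

Section Valuations.
Variable F : fieldType.
Implicit Types (v : F -> int) (x y : F).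

(* Only the values on nonzero elements matter; v 0 is junk, and vge is the
   comparison for the convention v 0 = +oo. *)
Record normalized_valuation v : Prop := NormalizedValuation {
  valM : forall x y, x != 0 -> y != 0 -> v (x * y) = v x + v y;
  valD : forall x y, x != 0 -> y != 0 -> x + y != 0 ->
    Num.min (v x) (v y) <= v (x + y);
  val_unif : exists2 x, x != 0 & v x = 1 }.

Definition vge v (i : int) x : bool := (x == 0) || (i <= v x).

Definition complete_valuation v : Prop :=
  forall u : nat -> F,
    (forall i : int, exists k, forall m n, (k <= m)%N -> (k <= n)%N ->
       vge v i (u m - u n)) ->
  exists l, forall i : int, exists k, forall n, (k <= n)%N -> vge v i (u n - l).

(* Residue field: the ring {v >= 0} modulo the ideal {v >= 1}. *)
Record p_field (p : nat) v : Prop := PField {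
  pfield_val : normalized_valuation v;
  pfield_complete : complete_valuation v;
  pfield_finite : exists s : seq F, forall x, vge v 0 x ->
    exists2 a, a \in s & vge v 0 a && vge v 1 (x - a);
  pfield_char : vge v 1 p%:R }.

End Valuations.

(* N is a finite galoisian extension of K in which all the extensions under
   consideration are taken, w a valuation of N; an extension F of K in N gets
   the restriction of w, which need not be normalized. *)
Section Extensions.
Variables (K : fieldType) (N : splittingFieldType K).
Variables (v : K -> int) (w : N -> int).
Implicit Types (E F L M : {subfield N}) (D : N -> Prop).

Definition extends_valuation : Prop :=
  exists2 e : nat, (0 < e)%N & forall x : K, x != 0 -> w x%:A = e%:Z * v x.

Definition uniformizer F (t : N) : Prop :=
  [/\ t \in F, t != 0, 0 < w t &
      forall x, x \in F -> x != 0 -> 0 < w x -> w t <= w x].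

(* The fractional ideal p_F^i of the ring of integers of F, i in Z. *)
Definition pideal F (i : int) (x : N) : Prop :=
  x \in F /\ exists2 t, uniformizer F t & vge w (i * w t) x.

Definition ramification_index F (e : nat) : Prop :=
  exists s t, [/\ uniformizer 1%AS s, uniformizer F t & w s = e%:Z * w t].

(* e_F = v_F(p), the ramification index over Q_p in characteristic 0. *)
Definition absolute_ramification_index (p : nat) F (e : nat) : Prop :=
  exists2 t, uniformizer F t & w p%:R = e%:Z * w t.

(* The trace of multiplication by x on the K-vector space E, for x in E. *)
Definition ext_trace E (x : N) : K :=
  \sum_(i < \dim E) coord (vbasis E) i (x * (vbasis E)`_i).

(* The codifferent {x | Tr(x O_E) is contained in O_K}, that is, the inverse
   of the different, equals p_E^(-d). *)
Definition different_exponent E (d : nat) : Prop :=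
  forall x, x \in E ->
    (forall y, pideal E 0 y -> vge v 0 (ext_trace E (x * y)))
    <-> pideal E (- d%:Z) x.

Definition differental_excess E (eps : int) : Prop :=
  exists d e : nat, [/\ different_exponent E d, ramification_index E e &
    eps = d%:Z - (e%:Z - 1)].

Definition primitive_ext E : Prop :=
  (1 < \dim E)%N /\
  forall F, (F <= E)%VS -> (F == 1 :> {vspace N})%VS || (F == E :> {vspace N}).

Definition wildly_primitive (p : nat) E : Prop :=
  [/\ primitive_ext E, exists n, \dim E = (p ^ n)%N &
      exists2 e, ramification_index E e & (1 < e)%N].

Definition splits_in (q : {poly N}) F : Prop :=
  exists2 s : seq N, q %= \prod_(z <- s) ('X - z%:P) & {subset s <= F}.

(* M is obtained from F by adjoining all the roots (in a separable closure)
   of all the polynomials in P; in particular all of them lie in N. *)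
Definition adjoin_roots F (P : {poly N} -> Prop) M : Prop :=
  [/\ (F <= M)%VS, forall q, P q -> splits_in q M &
      forall M', (F <= M')%VS -> (forall q, P q -> splits_in q M') ->
        (M <= M')%VS].

(* L = F(F^{x 1/e}) *)
Definition adjoin_all_radicals (e : nat) F L : Prop :=
  adjoin_roots F
    (fun q => exists x, [/\ x \in F, x != 0 & q = 'X^e - x%:P]) L.

Definition adjoin_radicals (p : nat) L D M : Prop :=
  adjoin_roots L (fun q => exists2 x, D x & q = 'X^p - x%:P) M.

Definition adjoin_wp_roots (p : nat) L D M : Prop :=
  adjoin_roots L (fun q => exists2 x, D x & q = 'X^p - 'X - x%:P) M.

(* Lower numbering: the condition defining C_i, and the break of
   C = Gal(M | L), i.e. C_c = C and C_(c+1) = 1. *)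
Definition in_ramification_group M (i : int) (g : gal_of M) : Prop :=
  forall x, pideal M 0 x -> pideal M (i + 1) (g x - x).

Definition ramification_break M L (c : int) : Prop :=
  (forall g, g \in 'Gal(M / L)%g -> in_ramification_group c g) /\
  (forall g, g \in 'Gal(M / L)%g -> in_ramification_group (c + 1) g -> g = 1%g).

(* Submodules of a quotient A/B (A a commutative group of exponent p modulo B,
   with law op, neutral element e and inverse inv) are represented by their
   preimages in A, i.e. by subgroups of A containing B; the F_p-structure is
   automatic, so an F_p[Gal(L | K)]-submodule is a Galois-stable subgroup. *)
Section Submodules.
Variables (L : {subfield N}) (A B : N -> Prop).
Variables (op : N -> N -> N) (e : N) (inv : N -> N).

Definition galois_submodule D : Prop :=
  [/\ forall x, D x -> A x,
      forall x, B x -> D x,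
      forall x y, D x -> D y -> D (op x y),
      forall x, D x -> D (inv x) &
      forall g, g \in 'Gal(L / 1)%g -> forall x, D x -> D (g x)].

Definition simple_galois_submodule D : Prop :=
  [/\ galois_submodule D, exists2 x, D x & ~ B x &
      forall D', galois_submodule D' -> (forall x, D' x -> D x) ->
        (forall x, D' x -> B x) \/ (forall x, D x -> D' x)].

(* D/B has an F_p-basis with n elements; the scalar a < p acts as the a-fold
   iterate of op. *)
Definition submodule_dim (p n : nat) D : Prop :=
  exists b : 'I_n -> N, (forall i, D (b i)) /\
    forall x, D x -> exists! a : {ffun 'I_n -> 'I_p},
      exists2 y, B y &
        x = op (\big[op/e]_(i < n) iter (a i) (op (b i)) e) y.

End Submodules.

Definition units_of L (x : N) : Prop := x \in L /\ x != 0.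

Definition unit_powers (p : nat) L (x : N) : Prop :=
  exists2 y, units_of L y & x = y ^+ p.

Definition wp_image (p : nat) L (x : N) : Prop :=
  exists2 y, y \in L & x = y ^+ p - y.

Definition simple_mul_submodule (p n : nat) L D : Prop :=
  simple_galois_submodule L (units_of L) (unit_powers p L) *%R GRing.inv D /\
  submodule_dim (unit_powers p L) *%R 1 p n D.

Definition simple_add_submodule (p n : nat) L D : Prop :=
  simple_galois_submodule L (fun x => x \in L) (wp_image p L) +%R -%R D /\
  submodule_dim (wp_image p L) +%R 0 p n D.

(* Preimage in L^x of the i-th step of the filtration of L^x/L^{x p}. *)
Definition in_Ubar (p : nat) L (i : nat) (x : N) : Prop :=
  units_of L x /\
  (i = 0%N \/ exists u y, [/\ pideal L i%:Z (u - 1), units_of L y & x = u * y ^+ p]).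

(* Preimage in L of the image of p_L^i in L^+/wp(L^+). *)
Definition in_pbar (p : nat) L (i : int) (x : N) : Prop :=
  exists z y, [/\ pideal L i z, wp_image p L y & x = z + y].

Definition mul_level (p : nat) L D (delta : int) : Prop :=
  exists e i : nat, [/\ absolute_ramification_index p L e,
    forall x, D x -> in_Ubar p L i x,
    forall x, D x -> in_Ubar p L i.+1 x -> unit_powers p L x &
    delta = (p * (e %/ p.-1))%N%:Z - i%:Z].

Definition add_level (p : nat) L D (delta : int) : Prop :=
  exists i : int, [/\ forall x, D x -> in_pbar p L i x,
    forall x, D x -> in_pbar p L (i + 1) x -> wp_image p L x &
    delta = - i].

End Extensions.

(* Main.v *)
(* Let q = p^n and let t, u, Pi be uniformizers of E, Ln, M.  Since E is primitive and
   ramified it is totally ramified, E = K(t), and Ln is unramified over K followed by the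
   adjunction of u = s^(1/(q-1)), s a uniformizer of K.  Hence Pi = u/t, the extension
   M | Ln is totally ramified of degree q, and t has valuation q-1 in M.

   gamma = eps: t and its conjugates over K are the g t, g in Gal(M | Ln), and
   w(t - g t) = w t + gamma w Pi for g <> 1 because q-1 is prime to p.  So the different
   of E, generated by f'(t) for f the minimal polynomial of t (Euler), has exponent
   q - 1 + gamma.

   gamma = delta: for x in D nontrivial, a suitable translate b of a root of X^p - x
   (resp. X^p - X - x) has valuation prime to p in Ln(b), and w(g b / b - 1) can be read
   off the level of x.  It determines the break of Ln(b) | Ln, and this is also the break
   of M | Ln, as in Herbrand's theorem for a filtration with a single break. *)

Require Import Defs.
From HB Require Import structures.
From mathcomp Require Import all_boot all_order all_algebra all_fingroup all_field.
From mathcomp Require Import all_solvable zify ring.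
From Stdlib Require Import Classical IndefiniteDescription.

Set Implicit Arguments.
Unset Strict Implicit.
Unset Printing Implicit Defensive.

Import Order.TTheory GRing.Theory Num.Theory.
Local Open Scope ring_scope.

(** Everything is an inequality for the one valuation [w] of [N]; residue fields are never formed,
    and roots of unity of order prime to [p] stand for their elements. Two facts rest on the
    completeness of [K], through the equivalence of norms on [N]: automorphisms preserve [w], which
    is only given as some valuation extending that of [K], and subspaces are closed, so that digit
    expansions yield [E = K(t)]. [Pi = u/t] because [w u = w s / (q-1)] and [w t = w s / q] differ
    by [w s / (q (q-1))]. The [q-1] factors of [f'(t)] contribute [(q-1) (w t + gamma w Pi)], and
    [(q-1) w Pi = w t]. This needs [g Pi / Pi] to be a 1-unit, that is [gamma > 0], which is only
    known from the level; so [delta] is treated first. The breaks of [Ln(b)] and [M] agree though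
    measured in different units: the elements of [Gal(M | Ln)] with a given nontrivial restriction
    to [Ln(b)] are [q/p] in number, and [(q/p) w Pi] is the valuation of a uniformizer of [Ln(b)].
    That [b] has valuation prime to [p] expresses the maximality of the filtration index: otherwise
    an approximation of [b] in [Ln] would raise it. *)

Section ValuationTheory.
Variables (F : fieldType) (v : F -> int).
Hypothesis v_val : normalized_valuation v.
Implicit Types (x y : F) (i j : int).

Lemma valuation1 : v 1 = 0.
Proof.
apply: (addrI (v 1)); rewrite addr0 -(Defs.valM v_val) ?oner_neq0 //.
by rewrite mulr1.
Qed.

Lemma valuationV x : x != 0 -> v x^-1 = - v x.
Proof.
move=> x0; have xV0 : x^-1 != 0 by rewrite invr_eq0.
by have := Defs.valM v_val x0 xV0; rewrite divff // valuation1; lia.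
Qed.

Lemma valuationN x : v (- x) = v x.
Proof.
have [->|x0] := eqVneq x 0; first by rewrite oppr0.
have m0 : (- 1 : F) != 0 by rewrite oppr_eq0 oner_neq0.
have := Defs.valM v_val m0 m0; rewrite mulrNN mulr1 valuation1 => m1.
by rewrite -mulN1r (Defs.valM v_val) //; lia.
Qed.

Lemma valuationX x k : x != 0 -> v (x ^+ k) = k%:Z * v x.
Proof.
move=> x0; elim: k => [|k IH]; first by rewrite expr0 valuation1 mul0r.
by rewrite exprS (Defs.valM v_val) ?expf_neq0 // IH -addn1 PoszD mulrDl mul1r addrC.
Qed.

Lemma vge0 i : vge v i 0.
Proof. by rewrite /vge eqxx. Qed.

Lemma vgeE i x : x != 0 -> vge v i x = (i <= v x).
Proof. by rewrite /vge => /negbTE->. Qed.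

Lemma vge_val i x : i <= v x -> vge v i x.
Proof. by move=> h; rewrite /vge h orbT. Qed.

Lemma vge_le i j x : i <= j -> vge v j x -> vge v i x.
Proof. by rewrite /vge => ij /orP[->//|jx]; rewrite (le_trans ij jx) orbT. Qed.

Lemma vge1 : vge v 0 1.
Proof. by apply: vge_val; rewrite valuation1. Qed.

Lemma vgeN i x : vge v i (- x) = vge v i x.
Proof. by rewrite /vge oppr_eq0 valuationN. Qed.

Lemma vgeD i x y : vge v i x -> vge v i y -> vge v i (x + y).
Proof.
have [->|x0] := eqVneq x 0; first by rewrite add0r.
have [->|y0] := eqVneq y 0; first by rewrite addr0.
have [->|xy0] := eqVneq (x + y) 0; first by rewrite vge0.
rewrite !vgeE // => ix iy; apply: le_trans (Defs.valD v_val x0 y0 xy0).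
by rewrite le_min ix.
Qed.

Lemma vgeB i x y : vge v i x -> vge v i y -> vge v i (x - y).
Proof. by move=> ix iy; rewrite vgeD // vgeN. Qed.

Lemma vgeBC i x y : vge v i (x - y) = vge v i (y - x).
Proof. by rewrite -opprB vgeN. Qed.

Lemma vge_trans i y x z : vge v i (x - y) -> vge v i (y - z) -> vge v i (x - z).
Proof. by move=> h1 h2; have := vgeD h1 h2; rewrite addrA subrK. Qed.

Lemma vgeM i j x y : vge v i x -> vge v j y -> vge v (i + j) (x * y).
Proof.
have [->|x0] := eqVneq x 0; first by rewrite mul0r !vge0.
have [->|y0] := eqVneq y 0; first by rewrite mulr0 !vge0.
by rewrite !vgeE ?mulf_neq0 // (Defs.valM v_val) // => ix jy; lia.
Qed.

Lemma vge0M i x y : vge v 0 x -> vge v i y -> vge v i (x * y).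
Proof. by move=> hx hy; have := vgeM hx hy; rewrite add0r. Qed.

Lemma vgeM0 i x y : vge v i x -> vge v 0 y -> vge v i (x * y).
Proof. by move=> hx hy; rewrite mulrC vge0M. Qed.

Lemma vge_pmul i x y : x != 0 -> vge v (v x + i) (x * y) = vge v i y.
Proof.
move=> x0; have [->|y0] := eqVneq y 0; first by rewrite mulr0 !vge0.
by rewrite !vgeE ?mulf_neq0 // (Defs.valM v_val) //; lia.
Qed.

Lemma vge_sum (I : Type) (r : seq I) (P : pred I) (G : I -> F) i :
  (forall k, P k -> vge v i (G k)) -> vge v i (\sum_(k <- r | P k) G k).
Proof. by move=> h; elim/big_ind: _ => //; [exact: vge0 | move=> *; exact: vgeD]. Qed.

Lemma vge0X k x : vge v 0 x -> vge v 0 (x ^+ k).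
Proof. by move=> h; elim: k => [|k IH]; rewrite ?expr0 ?vge1 // exprS vge0M. Qed.

Lemma vge_nat k : vge v 0 k%:R.
Proof. by elim: k => [|k IH]; rewrite ?vge0 // mulrSr vgeD ?vge1. Qed.

Lemma vge_eq0 x : (forall k : nat, vge v k%:Z x) -> x = 0.
Proof.
move=> h; apply/eqP/negPn/negP => x0.
by have := h `|v x|.+1%N; rewrite vgeE //; lia.
Qed.

Lemma valuationD_small x y : x != 0 -> vge v (v x + 1) y -> x + y != 0 /\ v (x + y) = v x.
Proof.
move=> x0 hy.
have h k : vge v k (x + y) -> v x < k -> false.
  move=> hk lk; have := vgeB (vge_le (_ : v x + 1 <= k) hk) hy.
  by rewrite addrK vgeE //; lia.
have xy0 : x + y != 0.
  by apply/eqP => e; have := h (v x + 1); rewrite e vge0 => /(_ isT); lia.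
split=> //; apply/eqP; rewrite eq_le.
have -> /= : v x <= v (x + y).
  by rewrite -vgeE // vgeD //; [exact: vge_val | apply: vge_le hy; lia].
by rewrite andbT leNgt; apply/negP => lt; have := h _ (vge_val (lexx _)) lt.
Qed.

Lemma valuation_prod (I : eqType) (r : seq I) (G : I -> F) :
  {in r, forall k, G k != 0} -> v (\prod_(k <- r) G k) = \sum_(k <- r) v (G k).
Proof.
move=> h; rewrite big_seq [in RHS]big_seq.
pose Q x (a : int) := x != 0 /\ v x = a.
suff [] : Q (\prod_(i <- r | i \in r) G i)
            (\sum_(i <- r | i \in r) v (G i)) by [].
apply: (big_rec2 Q) => [|k a x]; first by split; rewrite ?oner_neq0 ?valuation1.
move=> kr [x0 <-]; split; first by rewrite mulf_neq0 ?h.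
by rewrite (Defs.valM v_val) ?h.
Qed.

(** If some terms had valuation below [i], the smallest of them would dominate all others strictly
    and could not be cancelled. *)
Lemma vge_sum_distinct (I : finType) (G : I -> F) i :
  (forall j k : I, j != k -> G j != 0 -> G k != 0 -> v (G j) != v (G k)) ->
  vge v i (\sum_k G k) -> forall k, vge v i (G k).
Proof.
move=> dist hs k0; apply/negPn/negP => bad.
pose P := [pred k | ~~ vge v i (G k)].
have Pk0 : P k0 by [].
case: (@Order.TotalTheory.arg_minP _ _ _ k0 P (fun k => v (G k)) Pk0) => k Pk kmin.
have nzP (j : I) : P j -> G j != 0.
  by move=> Pj; apply/eqP => e; move: Pj; rewrite /= e vge0.
have lt : v (G k) < i by have := Pk; rewrite /= (vgeE _ (nzP _ Pk)) -ltNge.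
move: hs; rewrite (bigD1 k) //= => hs.
have rest : vge v (v (G k) + 1) (\sum_(j | j != k) G j).
  apply: vge_sum => j jk; have [Pj|nPj] := boolP (P j).
    apply: vge_val; have := kmin _ Pj; have := dist _ _ jk (nzP _ Pj) (nzP _ Pk).
    by lia.
  by move: nPj; rewrite /= negbK; apply: vge_le; lia.
have [s0 vs] := valuationD_small (nzP _ Pk) rest.
by move: hs; rewrite vgeE // vs; lia.
Qed.

End ValuationTheory.

Section ResidueCharacteristic.
Variables (F : fieldType) (v : F -> int) (p : nat).
Hypothesis v_val : normalized_valuation v.
Hypothesis p_prime : prime p.
Hypothesis vp : vge v 1 p%:R.
Implicit Types (x y s : F) (i : int).

Lemma vge_natC j : ~~ (p %| j)%N -> vge v 1 j%:R = false.
Proof.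
move=> pj; apply/negP => vj.
have: coprime j p by rewrite coprime_sym prime_coprime.
have j0 : (0 < j)%N by case: j pj {vj}; rewrite ?dvdn0.
case: (egcdnP p j0) => a b eab _; rewrite /coprime => /eqP g1.
have: vge v 1 1.
  have -> : (1 : F) = a%:R * j%:R - b%:R * p%:R.
    by rewrite -!natrM eab g1 natrD addrC addKr.
  by apply: vgeB => //; apply: vge0M => //; apply: vge_nat.
by rewrite vgeE ?oner_neq0 // valuation1.
Qed.

Lemma vge1_unit y : vge v 1 (y - 1) -> vge v 0 y.
Proof.
move=> h; rewrite -(subrK 1 y) vgeD ?vge1 //.
exact: vge_le h.
Qed.

Lemma valuation1_unit y : vge v 1 (y - 1) -> y != 0 /\ v y = 0.
Proof.
move=> h; rewrite -(subrK 1 y) addrC.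
have := @valuationD_small _ v v_val 1 (y - 1); rewrite valuation1 // add0r => H.
by apply: H; rewrite ?oner_neq0.
Qed.

Lemma vge_subX1 y j i : vge v 0 y -> vge v i (y - 1) -> vge v i (y ^+ j - 1).
Proof.
move=> y0 h; rewrite subrX1 vgeM0 //; apply: vge_sum => // k _.
exact: vge0X.
Qed.

Lemma vge_sumX y j : vge v 1 (y - 1) -> vge v 1 (\sum_(k < j) y ^+ k - j%:R).
Proof.
move=> h; have -> : j%:R = \sum_(k < j) (1 : F) by rewrite sumr_const card_ord.
rewrite -sumrB; apply: vge_sum => // k _; apply: vge_subX1 => //.
exact: vge1_unit.
Qed.

(** The cofactor of [y - 1] in [y ^+ j - 1] is congruent to [j], a unit when [p] does not divide
    [j]. Exponents prime to [p] are always exploited in this way below. *)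
Lemma vge_subX1E y j i : vge v 1 (y - 1) -> ~~ (p %| j)%N ->
  vge v i (y ^+ j - 1) = vge v i (y - 1).
Proof.
move=> h pj; rewrite subrX1 mulrC; set S := \sum_(k < j) _.
have SJ := vge_sumX j h; rewrite -/S in SJ.
have S1 : vge v 1 S = false.
  apply/negP => S1; have := vgeB v_val S1 SJ.
  by rewrite opprB addrC subrK vge_natC.
have S0 : S != 0 by apply: contraFneq S1 => ->; apply: vge0.
have vS : v S = 0.
  have : vge v 0 S by apply: vge_sum => // k _; apply/vge0X/vge1_unit.
  by move: S1; rewrite !vgeE //; lia.
by rewrite -[i in LHS]add0r -vS vge_pmul.
Qed.

Lemma unity_root_eq1 y j : vge v 1 (y - 1) -> ~~ (p %| j)%N -> y ^+ j = 1 -> y = 1.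
Proof.
move=> h pj yj; apply/eqP; rewrite -subr_eq0; apply/eqP.
apply: (vge_eq0 (v := v)) => k.
by rewrite -(vge_subX1E _ h pj) yj subrr vge0.
Qed.

(** The cofactor of [y - 1] in [y ^+ p - 1] is congruent to [p], hence of positive valuation. *)
Lemma vge_subXp y i : 1 <= i -> vge v i (y - 1) -> vge v (i + 1) (y ^+ p - 1).
Proof.
move=> i1 h; have h1 := vge_le i1 h; rewrite subrX1.
apply: vgeM => //; have := vge_sumX p h1 => h2.
by have := vgeD v_val h2 vp; rewrite subrK.
Qed.

Lemma vge_subXpk y k : vge v 1 (y - 1) -> vge v k.+1%:Z (y ^+ (p ^ k) - 1).
Proof.
move=> h; elim: k => [|k IH]; first by rewrite expn0 expr1.
rewrite expnSr exprM -addn1 PoszD; apply: vge_subXp => //; lia.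
Qed.

(** Injectivity of Frobenius on the residue field: with [y = 1 + s], the inner binomial coefficients
    are divisible by [p], so [y ^+ p - 1] is congruent to [s ^+ p]. *)
Lemma vge1_Xp y : vge v 0 y -> vge v 1 (y ^+ p - 1) -> vge v 1 (y - 1).
Proof.
move=> y0; set s := y - 1; have ys : y = 1 + s by rewrite addrC subrK.
have s0 : vge v 0 s by rewrite vgeB ?vge1.
have -> : y ^+ p - 1 = s ^+ p + \sum_(i < p | i != 0%N :> nat) s ^+ i *+ 'C(p, i).
  rewrite ys exprDn big_ord_recr /= binn mulr1n.
  under eq_bigr do rewrite expr1n mul1r.
  have p0 := prime_gt0 p_prime.
  rewrite (bigD1 (Ordinal p0)) //= bin0 expr0 mulr1n subnn expr0 mul1r.
  by rewrite addrAC [1 + _]addrC addrK addrC.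
move=> h; have : vge v 1 (s ^+ p).
  rewrite -[s ^+ p](addrK (\sum_(i < p | i != 0%N :> nat) s ^+ i *+ 'C(p, i))).
  apply: vgeB => //; apply: vge_sum => // i i0; rewrite -mulr_natr.
  have /dvdnP[c ->] : (p %| 'C(p, i))%N.
    by apply: prime_dvd_bin => //; rewrite lt0n i0 ltn_ord.
  rewrite natrM mulrA; rewrite -[1]add0r; apply: vgeM => //.
  by apply: vge0M; [| apply: vge0X | apply: vge_nat].
have [->|sn0] := eqVneq s 0; first by rewrite vge0.
rewrite !vgeE ?expf_neq0 // valuationX //; have := prime_gt0 p_prime.
by nia.
Qed.

Lemma vge1_Xcoprime y m : (0 < m)%N -> vge v 0 y -> vge v 1 (y ^+ m - 1) ->
  exists2 m', (0 < m')%N && ~~ (p %| m')%N & vge v 1 (y ^+ m' - 1).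
Proof.
move=> m0 y0; have [k pk ->] := pfactor_coprime p_prime m0.
elim: (logn p m) => [|l IH].
  rewrite expn0 muln1 => h; exists k => //.
  rewrite -prime_coprime // pk andbT lt0n.
  by apply: contraTneq pk => ->; rewrite /coprime gcdn0; case: p p_prime => [|[]].
by rewrite expnSr mulnA exprM => /vge1_Xp h; apply/IH/h/vge0X.
Qed.

End ResidueCharacteristic.

(** * Completeness of [K]: equivalence of norms on [N] and invariance of [w] *)

Section CompleteBase.
Variables (K : fieldType) (N : splittingFieldType K).
Variables (v : K -> int) (w : N -> int).
Hypothesis v_complete : complete_valuation v.
Hypothesis w_val : normalized_valuation w.
Hypothesis w_ext : extends_valuation v w.
Implicit Types (a l : nat -> K) (X : nat -> N) (m : nat) (i : int).

Lemma vge_alg i c : vge v i c -> 0 <= i -> vge w i c%:A.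
Proof.
have [e e0 we] := w_ext.
have [->|c0] := eqVneq c 0; first by rewrite scale0r !vge0.
by rewrite !vgeE ?scaler_eq0 ?negb_or ?c0 ?oner_neq0 // we //; nia.
Qed.

Lemma alg_vge i : exists j, forall c, vge w j c%:A -> vge v i c.
Proof.
have [e e0 we] := w_ext; exists (e%:Z * i) => c.
have [->|c0] := eqVneq c 0; first by rewrite vge0.
by rewrite !vgeE ?scaler_eq0 ?negb_or ?c0 ?oner_neq0 // we //; nia.
Qed.

Definition lincomb m X a : N := \sum_(j < m) a j *: X j.

Lemma lincombB m X a l : lincomb m X a - lincomb m X l = lincomb m X (fun j => a j - l j).
Proof. by rewrite -sumrB; apply: eq_bigr => j _; rewrite scalerBl. Qed.

(** The nontrivial half of the equivalence of norms: the loss [C] depends neither on the coordinates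
    nor on [i]. *)
Definition norm_bound m X := exists C : int, forall a i,
  vge w i (lincomb m X a) -> forall j, (j < m)%N -> vge w (i - C) (a j)%:A.

Definition cauchy (u : nat -> N) := forall i, exists k, forall r s,
  (k <= r)%N -> (k <= s)%N -> vge w i (u r - u s).

Definition converges (u : nat -> N) x := forall i, exists k, forall r,
  (k <= r)%N -> vge w i (u r - x).

(** The bound makes every coordinate sequence Cauchy in [K], where completeness supplies the
    limit. *)
Lemma norm_bound_lim m X (u : nat -> nat -> K) : norm_bound m X ->
  cauchy (fun r => lincomb m X (u r)) ->
  exists l, converges (fun r => lincomb m X (u r)) (lincomb m X l).
Proof.
move=> [C bound] cu.
have /functional_choice[l hl] : forall j, exists lj, (j < m)%N ->
    forall i, exists k, forall r, (k <= r)%N -> vge v i (u r j - lj).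
  move=> j; have [jm|mj] := ltnP j m; last by exists 0.
  have [|lj hlj] := @v_complete (fun r => u r j); last by exists lj.
  move=> i; have [i' hi'] := alg_vge i; have [k hk] := cu (i' + C).
  exists k => r s kr ks; apply: hi'.
  have := hk _ _ kr ks; rewrite lincombB => /bound /(_ _ jm).
  by rewrite addrK.
exists l => i.
have /functional_choice[k hk] : forall j, exists k, (j < m)%N -> forall r, (k <= r)%N ->
    vge w i ((u r j - l j) *: X j).
  move=> j; have [jm|mj] := ltnP j m; last by exists 0%N.
  have [k hk] := hl _ jm (`|i| + `|w (X j)|); exists k => _ r /hk h.
  rewrite -mulr_algl.
  have := vgeM w_val (vge_alg h _) (vge_val (lexx (w (X j)))).
  by move/(_ _)/vge_le; apply; lia.
exists (\max_(j < m) k j)%N => r kr; rewrite lincombB; apply: vge_sum => // j _.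
apply: hk => //; apply: leq_trans kr; exact: (leq_bigmax j).
Qed.

Lemma norm_bound_closed m X x : norm_bound m X ->
  (forall i, exists a, vge w i (x - lincomb m X a)) -> exists a, x = lincomb m X a.
Proof.
move=> bound clos.
have /functional_choice[u hu] : forall r : nat, exists a, vge w r%:Z (x - lincomb m X a).
  by move=> r; apply: clos.
have [|l hl] := @norm_bound_lim m X u bound.
  move=> i; exists `|i|%N => r s ir is_.
  have h1 : vge w i (x - lincomb m X (u r)) by apply: vge_le (hu r); lia.
  have h2 : vge w i (x - lincomb m X (u s)) by apply: vge_le (hu s); lia.
  by rewrite vgeBC // in h1; apply: vge_trans h1 h2.
exists l; apply/eqP; rewrite -subr_eq0; apply/eqP/(vge_eq0 (v := w)) => k.
have [k' hk'] := hl k%:Z.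
apply: (@vge_trans _ _ w_val _ (lincomb m X (u (maxn k k')))).
  by apply: vge_le (hu _); lia.
by apply: hk'; rewrite leq_maxr.
Qed.

(* Equivalence of norms: by induction the span of X 0, ..., X (m-1) is closed, so that
   X m stays at a positive distance from it. *)
Lemma norm_bound_free m X :
  (forall a, lincomb m X a = 0 -> forall j, (j < m)%N -> a j = 0) -> norm_bound m X.
Proof.
elim: m => [|m IH] free; first by exists 0.
have {}/IH IH : forall a, lincomb m X a = 0 -> forall j, (j < m)%N -> a j = 0.
  move=> a a0 j jm; pose a' k := if (k < m)%N then a k else 0.
  have := free a' _ j; rewrite /a' jm; apply; last exact: ltnW.
  rewrite /lincomb big_ord_recr /= ltnn scale0r addr0 -[RHS]a0.
  by apply: eq_bigr => k _; rewrite ltn_ord.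
have [i0 hi0] : exists i0, forall a, ~ vge w i0 (X m - lincomb m X a).
  apply: NNPP => h; have [||a Xm] := @norm_bound_closed m X (X m) => //.
    move=> i; apply: NNPP => hi; apply: h; exists i => a hia; apply: hi; by exists a.
  pose a' k := if (k < m)%N then a k else - 1.
  have := free a' _ m (ltnSn m); rewrite /a' ltnn => h'.
  have /eqP : (- 1 : K) = 0.
    apply: h'; rewrite /lincomb big_ord_recr /= ltnn scaleN1r Xm; apply/eqP.
    by rewrite subr_eq0; apply/eqP/eq_bigr => k _; rewrite ltn_ord.
  by rewrite oppr_eq0 oner_eq0.
have [C hC] := IH; exists (`|i0| + `|w (X m)| + `|C|) => a i ha.
pose A : N := (a m)%:A; have scA x : a m *: x = A * x by rewrite mulr_algl.
have ham : vge w (i - `|i0|) A.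
  have [am0|am0] := eqVneq (a m) 0; first by rewrite /A am0 scale0r vge0.
  have A0 : A != 0 by rewrite scaler_eq0 negb_or am0 oner_neq0.
  apply/negPn/negP; rewrite vgeE // -ltNge => lt.
  apply: (hi0 (fun j => - (a j / a m))).
  have -> : X m - lincomb m X (fun j => - (a j / a m)) = A^-1 * lincomb m.+1 X a.
    have -> : A^-1 = (a m)^-1%:A :> N by rewrite /A -!in_algE fmorphV.
    rewrite mulr_algl /lincomb big_ord_recr /= scalerDr scaler_sumr scalerA.
    rewrite mulVf // scale1r addrC -sumrN; congr (_ + _); apply: eq_bigr => k _.
    by rewrite scaleNr opprK scalerA mulrC.
  have := vgeM w_val (vge_val (lexx (w A^-1))) ha.
  by apply: vge_le; rewrite valuationV //; lia.
have hres : vge w (i - `|i0| - `|w (X m)|) (lincomb m X a).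
  have -> : lincomb m X a = lincomb m.+1 X a - a m *: X m.
    by rewrite /lincomb big_ord_recr /= addrK.
  apply: vgeB => //; first by apply: vge_le ha; lia.
  rewrite scA; have := vgeM w_val ham (vge_val (lexx (w (X m)))).
  by apply: vge_le; lia.
move=> j; rewrite ltnS leq_eqVlt => /orP[/eqP->|jm].
  by apply: vge_le ham; lia.
by apply: vge_le (hC _ _ hres _ jm); lia.
Qed.

Lemma vspace_norm_bound (V : {vspace N}) : exists m X,
  [/\ forall x, x \in V -> exists a, x = lincomb m X a,
      forall a, lincomb m X a \in V & norm_bound m X].
Proof.
set B := vbasis V; exists (\dim V), (fun j => B`_j); split.
- move=> x xV; exists (fun j => if insub j is Some k then coord B k x else 0).
  by rewrite {1}(coord_vbasis xV); apply: eq_bigr => j _; rewrite valK.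
- by move=> a; apply: memv_suml => j _; apply/memvZ/vbasis_mem/mem_nth; rewrite size_tuple.
apply: norm_bound_free => a a0 j jm.
have /freeP := basis_free (vbasisP V).
by move=> /(_ (fun k => a k) a0 (Ordinal jm)).
Qed.

(** Turns an expansion known to every finite order into membership. *)
Lemma vspace_closed (V : {vspace N}) x :
  (forall i, exists2 y, y \in V & vge w i (x - y)) -> x \in V.
Proof.
have [m [X [VX XV bound]]] := vspace_norm_bound V => clos.
have [|a ->] := @norm_bound_closed m X x bound; last exact: XV.
by move=> i; have [y /VX[a ->] h] := clos i; exists a.
Qed.

Lemma extension_complete u : cauchy u -> exists x, converges u x.
Proof.
have [m [X [VX XV bound]]] := vspace_norm_bound {:N} => cu.
have /functional_choice[a ha] : forall r, exists a, u r = lincomb m X a.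
  by move=> r; apply: VX; apply: memvf.
have [|l hl] := @norm_bound_lim m X a bound.
  by move=> i; have [k hk] := cu i; exists k => r s kr ks; rewrite -!ha; apply: hk.
by exists (lincomb m X l) => i; have [k hk] := hl i; exists k => r kr; rewrite ha; apply: hk.
Qed.

(* A second valuation extending that of K differs from the first by a bounded
   amount, hence not at all, since both are multiplicative. *)
Lemma val_aut_ge (f : 'AEnd(N)) x : x != 0 -> w x <= w (f x).
Proof.
move=> x0; have f0 y : y != 0 -> f y != 0 by rewrite fmorph_eq0.
have [m [X [VX _ [C bound]]]] := vspace_norm_bound {:N}.
have [B hB] : exists B : nat, forall j, (j < m)%N -> - B%:Z <= w (f (X j)).
  exists (\max_(j < m) `|w (f (X j))|)%N => j jm.
  have := @leq_bigmax _ (fun j : 'I_m => `|w (f (X j))|%N) (Ordinal jm).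
  by rewrite /=; lia.
have key y : y != 0 -> w y - (`|C| + B%:Z) <= w (f y).
  move=> y0; have [a ya] := VX y (memvf y).
  rewrite -vgeE ?f0 // {2}ya /lincomb linear_sum; apply: vge_sum => // j _.
  rewrite linearZ /= -mulr_algl.
  have ha : vge w (w y - C) (a j)%:A by apply: bound => //; rewrite -ya vge_val.
  have := vgeM w_val ha (vge_val (hB j (ltn_ord j))).
  by apply: vge_le; lia.
rewrite leNgt; apply/negP => lt.
pose n := (`|C| + B).+1%N.
have := key (x ^+ n) (expf_neq0 _ x0).
rewrite rmorphXn /= !valuationX ?f0 // /n; nia.
Qed.

Lemma val_aut (f : 'AEnd(N)) x : w (f x) = w x.
Proof.
have [->|x0] := eqVneq x 0; first by rewrite linear0.
apply/eqP; rewrite eq_le val_aut_ge // andbT.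
have fx0 : f x != 0 by rewrite fmorph_eq0.
have := @val_aut_ge (inv_ahom f) (f x) fx0.
by rewrite /= lker0_lfunK // AEnd_lker0.
Qed.

Lemma vge_aut (f : 'AEnd(N)) i x : vge w i (f x) = vge w i x.
Proof. by rewrite /vge val_aut fmorph_eq0. Qed.

End CompleteBase.

(** * Gauss valuation of polynomials *)

Section GaussValuation.
Variables (F : fieldType) (v : F -> int).
Hypothesis v_val : normalized_valuation v.
Implicit Types (h q : {poly F}) (i j : int).

Definition pge i h := forall k, vge v i h`_k.

Lemma pgeD i h q : pge i h -> pge i q -> pge i (h + q).
Proof. by move=> hh hq k; rewrite coefD vgeD. Qed.

Lemma pgeB i h q : pge i h -> pge i q -> pge i (h - q).
Proof. by move=> hh hq k; rewrite coefB vgeB. Qed.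

Lemma pgeC i c : vge v i c -> pge i c%:P.
Proof. by move=> hc k; rewrite coefC; case: eqP => // _; apply: vge0. Qed.

Lemma pgeM i j h q : pge i h -> pge j q -> pge (i + j) (h * q).
Proof. by move=> hh hq k; rewrite coefM; apply: vge_sum => // l _; apply: vgeM. Qed.

Lemma pge_XsubC c : vge v 0 c -> pge 0 ('X - c%:P).
Proof.
move=> hc; apply: pgeB; last exact: pgeC.
by move=> k; rewrite coefX; case: eqP => _; [apply: vge1 | apply: vge0].
Qed.

Lemma pge_prod_XsubC (rs : seq F) : (forall r, r \in rs -> vge v 0 r) ->
  pge 0 (\prod_(r <- rs) ('X - r%:P)).
Proof.
elim: rs => [|r rs IH] h; first by rewrite big_nil; apply/pgeC/vge1.
rewrite big_cons -[0]addr0; apply: pgeM; first by apply/pge_XsubC/h/mem_head.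
by apply: IH => s sr; apply: h; rewrite inE sr orbT.
Qed.

Lemma vge_horner i h x : pge i h -> vge v 0 x -> vge v i h.[x].
Proof.
move=> hh hx; rewrite horner_coef; apply: vge_sum => // k _.
by apply: vgeM0 => //; apply: vge0X.
Qed.

(** The coefficients of the quotient are recovered from the top down, each from the next one and
    [r], without any division. *)
Lemma pge_divXsubC i q r : vge v 0 r -> pge i (q * ('X - r%:P)) -> pge i q.
Proof.
move=> hr hq; suff H (k j : nat) : (size q <= j + k)%N -> vge v i q`_j.
  by move=> j; apply: (H (size q)); rewrite leq_addl.
elim: k j => [|k IH] j le; first by rewrite nth_default ?vge0 // -[j]addn0.
have -> : q`_j = (q * ('X - r%:P))`_j.+1 + r * q`_j.+1.
  by rewrite mulrBr coefB coefMX coefMC /= [r * _]mulrC subrK.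
by apply: vgeD => //; apply: vge0M => //; apply: IH; rewrite addSnnS.
Qed.

Lemma divXsubC (h : {poly F}) r : exists2 q, h = q * ('X - r%:P) + (h.[r])%:P &
  size q = (size h).-1.
Proof.
have : root (h - (h.[r])%:P) r by rewrite rootE !hornerE subrr.
move=> /factor_theorem[q hq]; exists q; first by rewrite -hq subrK.
have eh : h = q * ('X - r%:P) + (h.[r])%:P by rewrite -hq subrK.
have [q0|q0] := eqVneq q 0.
  rewrite q0 mul0r add0r in eh; rewrite q0 size_poly0 eh size_polyC.
  by case: eqP.
have sq : size (q * ('X - r%:P)) = (size q).+1.
  by rewrite size_Mmonic ?monicXsubC // size_XsubC addn2.
rewrite eh size_polyDl sq // size_polyC.
by apply: leq_ltn_trans (leq_b1 _) _; rewrite ltnS lt0n size_poly_eq0.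
Qed.

Definition incongruent (rs : seq F) :=
  forall r s, r \in rs -> s \in rs -> vge v 1 (r - s) -> r = s.

Lemma vge_nonmultiple i x y : vge v 0 x -> vge v 1 x = false ->
  vge v i (x * y) = vge v i y.
Proof.
move=> x0 x1; have xn0 : x != 0 by apply: contraFneq x1 => ->; apply: vge0.
have vx : v x = 0 by move: x0 x1; rewrite !vgeE //; lia.
by rewrite -[i in LHS]add0r -vx vge_pmul.
Qed.

(** This is the vanishing of a polynomial over the residue field with more distinct roots than its
    degree. A root [r] is split off over [F] itself, and the remaining values may be divided by
    [s - r], a unit by incongruence. *)
Lemma pge1_incongruent (rs : seq F) h :
  uniq rs -> incongruent rs -> (forall r, r \in rs -> vge v 0 r) ->
  pge 0 h -> (size h <= size rs)%N -> (forall r, r \in rs -> vge v 1 h.[r]) ->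
  pge 1 h.
Proof.
elim: rs h => [|r rs IH] h /=.
  by move=> _ _ _ _; rewrite leqn0 size_poly_eq0 => /eqP-> _ k; rewrite coef0 vge0.
move=> /andP[rrs urs] inc rs0 h0 sh hr.
have [q eh sq] := divXsubC h r.
have q0 : pge 0 q.
  apply: (@pge_divXsubC _ _ r); first by apply: rs0; rewrite mem_head.
  have -> : q * ('X - r%:P) = h - (h.[r])%:P by rewrite {1}eh addrK.
  apply: pgeB => //; apply: pgeC; apply: vge_horner => //.
  by apply: rs0; rewrite mem_head.
have q1 : pge 1 q.
  apply: IH => //.
  - by move=> s t hs ht; apply: inc; rewrite inE ?hs ?ht orbT.
  - by move=> s hs; apply: rs0; rewrite inE hs orbT.
  - by rewrite sq; case: (size h) sh.
  move=> s hs; have sin : s \in r :: rs by rewrite inE hs orbT.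
  have rin : r \in r :: rs by rewrite mem_head.
  rewrite -(@vge_nonmultiple _ (s - r)); last 1 first.
  - apply/negP => /(inc _ _ sin rin) sr; by rewrite -sr hs in rrs.
  - have -> : (s - r) * q.[s] = h.[s] - h.[r].
      by rewrite [in h.[s]]eh !hornerE addrK mulrC.
    by apply: vgeB; rewrite ?hr.
  by apply: vgeB; rewrite ?rs0.
rewrite eh; apply: pgeD; last by apply/pgeC/hr/mem_head.
by rewrite -[1]addr0; apply: pgeM => //; apply/pge_XsubC/rs0/mem_head.
Qed.

End GaussValuation.

(** * Teichmuller representatives and unramified extensions *)

Section PFieldExtension.
Variables (p : nat) (K : fieldType) (v : K -> int) (N : splittingFieldType K) (w : N -> int).
Hypothesis p_prime : prime p.
Hypothesis K_pfield : p_field p v.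
Hypothesis N_galois : galois 1%AS {:N}%AS.
Hypothesis w_val : normalized_valuation w.
Hypothesis w_ext : extends_valuation v w.

Let v_val := pfield_val K_pfield.
Let v_complete := pfield_complete K_pfield.
Let vge_autN := vge_aut v_complete w_val w_ext.

Lemma vge_p : vge w 1 p%:R.
Proof.
have := vge_alg w_ext (pfield_char K_pfield) isT.
by rewrite -in_algE rmorph_nat.
Qed.

Lemma base_valuation_onto (j : int) : exists2 c : K, c != 0 & v c = j.
Proof.
have [c c0 vc] := val_unif v_val; case: j => k.
  by exists (c ^+ k); rewrite ?expf_neq0 // valuationX // vc mulr1.
exists (c ^+ k.+1)^-1; rewrite ?invr_eq0 ?expf_neq0 //.
by rewrite valuationV ?expf_neq0 // valuationX // vc; lia.
Qed.

Lemma base_residues_finite (i : int) (m : nat) : exists s : seq K, forall x, vge v i x ->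
  exists2 a, a \in s & vge v (i + m%:Z) (x - a).
Proof.
elim: m => [|m [s hs]].
  by exists [:: 0] => x hx; exists 0; rewrite ?inE // addr0 subr0.
have [c c0 vc] := base_valuation_onto (i + m%:Z).
have [s0 hs0] := pfield_finite K_pfield.
exists [seq a + c * b | a <- s, b <- s0] => x /hs[a as_ ha].
have [|b bs /andP[_ hb]] := hs0 (c^-1 * (x - a)).
  by rewrite -(@vge_pmul _ _ v_val _ c) // mulrA divff // mul1r vc addr0.
exists (a + c * b); first by apply/allpairsP; exists (a, b).
have -> : x - (a + c * b) = c * (c^-1 * (x - a) - b).
  by rewrite mulrBr mulrA divff // mul1r opprD addrA.
have -> : i + m.+1%:Z = v c + 1 by rewrite vc; lia.
by rewrite vge_pmul.
Qed.

Lemma lincomb_residues_finite (X : nat -> N) (i : int) (m : nat) : exists s : seq N,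
  forall a : nat -> K, (forall j, (j < m)%N -> vge v i (a j)) ->
  exists2 y, y \in s & vge w 1 (lincomb m X a - y).
Proof.
elim: m => [|m [s hs]].
  by exists [:: 0] => a _; exists 0; rewrite ?inE // /lincomb big_ord0 subrr vge0.
(* The precision absorbs the valuation of [X m] and leaves 1 over; the term [|i|] makes the order of
   the error nonnegative, as the passage from [v] to [w] requires. *)
have [s0 hs0] := base_residues_finite i (`|i| + `|w (X m)| + 1)%N.
exists [seq y + b *: X m | y <- s, b <- s0] => a ha.
have [|y ys hy] := hs a; first by move=> j jm; apply/ha/ltnW.
have [b bs hb] := hs0 _ (ha m (ltnSn m)).
exists (y + b *: X m); first by apply/allpairsP; exists (y, b).
have -> : lincomb m.+1 X a - (y + b *: X m) = (lincomb m X a - y) + (a m - b) *: X m.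
  by rewrite /lincomb big_ord_recr /= scalerBl opprD addrACA.
apply: vgeD => //; rewrite -mulr_algl.
have i0 : 0 <= i + (`|i| + `|w (X m)| + 1)%N%:Z by lia.
have := vgeM w_val (vge_alg w_ext hb i0) (vge_val (lexx (w (X m)))).
by apply: vge_le; lia.
Qed.

(** By the norm bound, integral elements have coordinates in a fixed fractional ideal of [K], where
    finitely many classes suffice. *)
Lemma residues_finite : exists s : seq N, forall x, vge w 0 x ->
  exists2 y, y \in s & vge w 1 (x - y).
Proof.
have [m [X [VX _ [C bound]]]] := vspace_norm_bound v_complete w_val w_ext {:N}.
have [i hi] : exists i, forall c : K, vge w (0 - C) c%:A -> vge v i c.
  have [e e0 we] := w_ext; exists (- `|C|) => c.
  have [->|c0] := eqVneq c 0; first by rewrite !vge0.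
  rewrite !vgeE // ?we //; last by rewrite scaler_eq0 negb_or c0 oner_neq0.
  by nia.
have [s hs] := lincomb_residues_finite X i m; exists s => x x0.
have [a ea] := VX x (memvf x); rewrite ea.
apply: hs => j jm; apply/hi/bound => //; by rewrite -ea.
Qed.

(** Two powers of [x] are congruent by the pigeonhole principle; the [p]-part of the exponent so
    found is removed by injectivity of Frobenius. *)
Lemma unit_expn_congr1 x : x != 0 -> w x = 0 ->
  exists2 m, (0 < m)%N && ~~ (p %| m)%N & vge w 1 (x ^+ m - 1).
Proof.
move=> x0 wx; have hx : vge w 0 x by apply: vge_val; rewrite wx.
suff [m m0] : exists2 m, (0 < m)%N & vge w 1 (x ^+ m - 1).
  exact: (vge1_Xcoprime w_val p_prime vge_p m0 hx).
have [s hs] := residues_finite.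
pose P i a := vge w 1 (x ^+ i - a).
have fs i : (find (P i) s < size s)%N.
  rewrite -has_find; have [y ys hy] := hs (x ^+ i) (vge0X w_val i hx).
  by apply/hasP; exists y.
pose f (i : 'I_(size s).+1) := Ordinal (fs i).
have : ~~ injectiveb f.
  by apply/negP => /injectiveP/leq_card; rewrite !card_ord ltnn.
have key (i j : nat) : (i < j)%N -> find (P i) s = find (P j) s ->
    exists2 m, (0 < m)%N & vge w 1 (x ^+ m - 1).
  move=> ij e; exists (j - i)%N; first by rewrite subn_gt0.
  have hp k : P k (nth 0 s (find (P k) s)) by apply: nth_find; rewrite has_find.
  have h1 := hp i; have h2 := hp j; rewrite e /P in h1; rewrite /P vgeBC // in h2.
  have := vge_trans w_val h1 h2; rewrite vgeBC //.
  have -> : x ^+ j - x ^+ i = x ^+ i * (x ^+ (j - i) - 1).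
    by rewrite mulrBr mulr1 -exprD subnKC // ltnW.
  have := @vge_pmul _ _ w_val 1 (x ^+ i) (x ^+ (j - i) - 1) (expf_neq0 _ x0).
  by rewrite valuationX // wx mulr0 add0r => ->.
case/injectivePn => i [j ij /(congr1 val) /= e].
by case: (ltngtP i j) => [lt|lt|/val_inj eij]; [apply: key lt e | apply: key lt (esym e) | rewrite eij eqxx in ij].
Qed.

(** The Teichmuller representatives in [N]. The condition on [m] also excludes [m = 0]. *)
Definition tame_root (o : N) := exists2 m, ~~ (p %| m)%N & o ^+ m = 1.

Lemma tame_root_val o : tame_root o -> o != 0 /\ w o = 0.
Proof.
move=> [m pm om]; have m0 : (0 < m)%N by case: m pm {om}; rewrite ?dvdn0.
have o0 : o != 0.
  by apply/eqP => e; move/eqP: om; rewrite e expr0n gtn_eqF // eq_sym oner_eq0.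
split=> //; have := valuationX w_val m o0; rewrite om valuation1 //; nia.
Qed.

Lemma tame_root_div o u : tame_root o -> tame_root u -> tame_root (o / u).
Proof.
move=> [m pm om] [k pk uk]; exists (m * k)%N.
  by rewrite Euclid_dvdM // negb_or pm.
by rewrite expr_div_n exprM om expr1n mulnC exprM uk expr1n invr1 mulr1.
Qed.

(** The quotient is congruent to 1 and killed by an exponent prime to [p], hence is 1. So reduction
    is injective on these roots. *)
Lemma tame_root_congr o u : tame_root o -> tame_root u -> vge w 1 (o - u) -> o = u.
Proof.
move=> to tu h; have [u0 wu] := tame_root_val tu.
have [m pm oum] := tame_root_div to tu.
apply: (divIf u0); rewrite divff //.
apply: (unity_root_eq1 w_val p_prime vge_p _ pm oum).
rewrite -(@vge_pmul _ _ w_val _ u) // wu add0r mulrBr mulr1 mulrCA divff //.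
by rewrite mulr1.
Qed.

Lemma tame_root_aut (f : 'AEnd(N)) o : tame_root o -> tame_root (f o).
Proof. by move=> [m pm om]; exists m; rewrite // -rmorphXn om rmorph1. Qed.

(** The representative is the limit of the powers [x ^+ (Q ^ j)] for a suitable power [Q] of [p]. *)
Lemma teichmuller x : x != 0 -> w x = 0 -> exists2 o, tame_root o & vge w 1 (x - o).
Proof.
move=> x0 wx; have hx : vge w 0 x by apply: vge_val; rewrite wx.
have [m /andP[m0 pm] xm] := unit_expn_congr1 x0 wx.
have mp : coprime p m by rewrite prime_coprime.
have t0 : (0 < totient m)%N by rewrite totient_gt0.
(* By Euler's theorem [m] divides [Q - 1], so [x ^+ (Q - 1)] is congruent to 1; as [Q] is a power of
   [p], raising to the powers [Q ^ j] brings it ever closer to 1. *)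
set Q := (p ^ totient m)%N.
have p0 := prime_gt0 p_prime.
have Q0 : (0 < Q)%N by rewrite expn_gt0 p0.
have mQ : (m %| Q - 1)%N by rewrite -eqn_mod_dvd // Euler_exp_totient.
have pQ : ~~ (p %| Q - 1)%N.
  apply/negP => h; have := dvdn_sub (dvdn_exp t0 (dvdnn p)) h.
  by rewrite subKn // dvdn1 => /eqP p1; move: p_prime; rewrite p1.
have xQ : vge w 1 (x ^+ (Q - 1) - 1).
  by have /dvdnP[c ->] := mQ; rewrite mulnC exprM; apply: vge_subX1 => //; apply: vge0X.
pose u j := x ^+ (Q ^ j).
have u0 j : vge w 0 (u j) by apply: vge0X.
have uS j : u j.+1 = u j ^+ Q by rewrite /u expnSr exprM.
have step j : vge w j.+1%:Z (u j.+1 - u j).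
  have -> : u j.+1 - u j = u j * ((x ^+ (Q - 1)) ^+ (Q ^ j) - 1).
    rewrite mulrBr mulr1 -!exprM -exprD; congr (x ^+ _ - _).
    by rewrite expnS -[X in (X + _)%N]mul1n -mulnDl subnKC.
  apply: vge0M => //; rewrite /Q -expnM.
  have : vge w (totient m * j).+1%:Z ((x ^+ (Q - 1)) ^+ (p ^ (totient m * j)) - 1).
    exact: (vge_subXpk w_val vge_p _ xQ).
  by apply: vge_le; nia.
have dist i j : vge w i.+1%:Z (u (i + j)%N - u i).
  elim: j => [|j IH]; first by rewrite addn0 subrr vge0.
  rewrite addnS; apply: vge_trans IH => //.
  by apply: vge_le (step _); lia.
have [|o ho] := extension_complete v_complete w_val w_ext (u := u).
  move=> i; exists `|i|%N => r s ir is_.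
  have d r' : (`|i| <= r')%N -> vge w i (u r' - u `|i|%N).
    by move=> le; rewrite -(subnKC le); apply: vge_le (dist _ _); lia.
  by have := d _ is_; rewrite vgeBC //; apply: vge_trans (d _ ir).
have xo : vge w 1 (x - o).
  have [k hk] := ho 1; have := dist 0%N k; rewrite add0n vgeBC // => h.
  by have := vge_trans w_val h (hk k (leqnn k)); rewrite /u expn0 expr1.
have o_0 : vge w 0 o.
  rewrite -(subrK x o) vgeD // vgeBC //; exact: vge_le xo.
have oQ : o ^+ Q = o.
  apply/eqP; rewrite -subr_eq0; apply/eqP/(vge_eq0 (v := w)) => k.
  have [r hr] := ho k%:Z; have h := hr (maxn k r) (leq_maxr _ _).
  apply: (@vge_trans _ _ w_val _ (u (maxn k r).+1)).
    rewrite uS vgeBC // subrXX; apply: vgeM0 => //; apply: vge_sum => // j _.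
    by apply: vge0M => //; apply: vge0X.
  by apply: hr; rewrite leqW // leq_maxr.
exists o => //; exists (Q - 1)%N => //.
have on0 : o != 0.
  apply/eqP => e; by move: xo; rewrite e subr0 vgeE // wx.
by apply: (mulfI on0); rewrite mulr1 -exprS subn1 prednK.
Qed.

(** Scale the polynomial expressing [x] in [o] so that a coefficient of least valuation becomes 1.
    If its value at [o] were not a unit, neither would be its values at the conjugates of [o]; these
    are pairwise incongruent and more numerous than the degree, so every coefficient would be a
    nonunit, against the coefficient 1. *)
Lemma unramified_adjoin (F : {subfield N}) o x : tame_root o -> x \in <<F; o>>%VS ->
  x != 0 -> exists a, [/\ a \in F, a != 0 & w a = w x].
Proof.
move=> to xFo x0; set P := Fadjoin_poly F o x.
have eP : P.[o] = x by apply: Fadjoin_poly_eq.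
have PF : P \is a polyOver F by apply: Fadjoin_polyOver.
have P0 : P != 0 by apply: contra_neq x0 => e; rewrite -eP e horner0.
have hlc : P`_(size P).-1 != 0 by rewrite -lead_coefE lead_coef_eq0.
have sP0 : (0 < size P)%N by rewrite lt0n size_poly_eq0.
have ltp : ((size P).-1 < size P)%N by rewrite ltn_predL.
pose D := [pred k : 'I_(size P) | P`_k != 0].
case: (@Order.TotalTheory.arg_minP _ _ _ (Ordinal ltp) D (fun k => w P`_k) hlc) => k Pk kmin.
set a := P`_k in Pk; have aF : a \in F by apply: (polyOverP PF).
exists a; split=> //.
pose h := a^-1 *: P.
have hF : h \is a polyOver F by rewrite polyOverZ ?memvV.
have h0 : pge w 0 h.
  move=> j; rewrite coefZ -(@vge_pmul _ _ w_val _ a) // mulrA divff // mul1r addr0.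
  have [js|sj] := ltnP j (size P); last by rewrite nth_default ?vge0.
  have [->|Pj] := eqVneq P`_j 0; first exact: vge0.
  by rewrite vgeE //; apply: (kmin (Ordinal js)).
have hx : h.[o] = a^-1 * x by rewrite hornerZ eP.
have [o0 wo] := tame_root_val to; have io : vge w 0 o by rewrite vge_val ?wo.
have ge : vge w 0 (a^-1 * x) by rewrite -hx; apply: vge_horner.
have [lt|/negP nlt] := boolP (vge w 1 (a^-1 * x)); last first.
  have ax0 : a^-1 * x != 0 by rewrite mulf_neq0 ?invr_eq0.
  move: ge nlt; rewrite !vgeE // (Defs.valM w_val) ?invr_eq0 // valuationV //.
  by move: (w a) (w x) => A B; clear; lia.
have galF : galois F {:N}%AS by apply: galoisS N_galois; rewrite sub1v subvf.
have /(galois_factors (subvf F))/(_ o (memvf o))[r [rG ur er]] := galF.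
suff /(_ k) : pge w 1 h.
  by rewrite coefZ -/a mulVf // vgeE ?oner_neq0 // valuation1.
apply: (pge1_incongruent w_val ur) => //.
- by move=> _ _ /mapP[z1 _ ->] /mapP[z2 _ ->]; apply: tame_root_congr; exact: tame_root_aut.
- by move=> _ /mapP[z _ ->]; rewrite vge_autN.
- apply: leq_trans (_ : adjoin_degree F o <= _)%N.
    by rewrite size_scale ?invr_eq0 //; apply: size_Fadjoin_poly.
  have := size_minPoly F o; rewrite er size_prod_XsubC => /eqP.
  by rewrite eqSS size_map => /eqP->.
move=> _ /mapP[z zr ->]; have zG := subsetP rG _ zr.
have <- : z h.[o] = h.[z o].
  by rewrite -horner_map /= (fixedPoly_gal (subvf F) zG).
by rewrite vge_autN hx.
Qed.

(** Plays the role of the maximal unramified extension of [F] in [N]: tame roots are adjoined one at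
    a time, without new values, until the dimension of [N] ends the process. *)
Lemma max_unramified (F : {subfield N}) : exists F' : {subfield N},
  [/\ (F <= F')%VS, forall o, tame_root o -> o \in F' &
      forall x, x \in F' -> x != 0 -> exists a, [/\ a \in F, a != 0 & w a = w x]].
Proof.
have [k] := ubnP (\dim {:N} - \dim F); elim: k F => // k IH F le.
case: (classic (forall o, tame_root o -> o \in F)) => [h|/not_all_ex_not[o ho]].
  by exists F; split=> // x xF x0; exists x.
have [to /negP oF] := imply_to_and _ _ ho.
have lt : (\dim F < \dim <<F; o>>)%N.
  rewrite ltn_neqAle (dimvS (subv_adjoin F o)) andbT; apply/eqP => e.
  have := eqEdim F <<F; o>>%VS; rewrite subv_adjoin e leqnn => /eqP eF.
  by move/negP: oF; rewrite {1}eF memv_adjoin.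
have le2 := dimvS (subvf <<F; o>>%VS).
have [|F' [FF' tF' vF']] := IH <<F; o>>%AS.
  by rewrite ltnS in le; apply: leq_trans le; apply: ltn_sub2l => //; apply: leq_trans le2.
exists F'; split=> //; first exact: subv_trans (subv_adjoin F o) FF'.
move=> x xF' x0; have [b [bF b0 <-]] := vF' x xF' x0.
have [a [aF a0 <-]] := unramified_adjoin to bF b0.
by exists a.
Qed.

End PFieldExtension.

Lemma dvdn_intmul (k : int) (e j : nat) : k * e%:Z = j%:Z -> (e %| j)%N.
Proof. by move/(congr1 absz); rewrite abszM /= => <-; apply: dvdn_mull. Qed.

Lemma int_euclid (k : int) (e : nat) : (0 < e)%N ->
  exists a (j : nat), (j < e)%N /\ k = a * e%:Z + j%:Z.
Proof.
move=> e0; have ez : e%:Z != 0 by lia.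
exists (k %/ e%:Z)%Z, `|(k %% e%:Z)%Z|%N.
by rewrite gez0_abs ?modz_ge0 // -divz_eq -ltz_nat gez0_abs ?modz_ge0 ?ltz_pmod.
Qed.

(** * Uniformizers and expansions in powers of one element *)

Section Subextensions.
Variables (K : fieldType) (N : splittingFieldType K) (w : N -> int).
Hypothesis w_val : normalized_valuation w.
Implicit Types (F E L M : {subfield N}) (x y t b : N).

Lemma valuation_exprz t (k : int) : t != 0 -> w (t ^ k) = k * w t.
Proof.
move=> t0; case: k => k; first by rewrite -exprnP valuationX.
by rewrite NegzE -exprnN valuationV ?expf_neq0 // valuationX // mulNr.
Qed.

Lemma memv_exprz F t (k : int) : t \in F -> t ^ k \in F.
Proof.
move=> tF; case: k => k; first by rewrite -exprnP rpredX.
by rewrite NegzE -exprnN memvV rpredX.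
Qed.

Lemma uniformizer_exists F : (exists2 x, x \in F & x != 0 /\ 0 < w x) ->
  exists t, uniformizer w F t.
Proof.
move=> [x xF [x0 wx]]; have [k] := ubnP `|w x|%N.
elim: k x xF x0 wx => // k IH x xF x0 wx le.
case: (classic (exists2 y, y \in F & [/\ y != 0, 0 < w y & w y < w x])) => [[y yF [y0 wy lt]]|no].
  by apply: (IH y) => //; lia.
exists x; split=> // y yF y0 wy; rewrite leNgt; apply/negP => lt.
by apply: no; exists y.
Qed.

Lemma uniformizer_dvd F t x : uniformizer w F t -> x \in F -> x != 0 ->
  exists k, w x = k * w t.
Proof.
move=> [tF t0 wt min] xF x0; exists (w x %/ w t)%Z.
have td0 k : t ^ k != 0 by rewrite expfz_neq0.
set k := (w x %/ w t)%Z.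
pose y := x * t ^ (- k).
have yF : y \in F by rewrite memvM ?memv_exprz.
have y0 : y != 0 by rewrite mulf_neq0.
have wy : w y = w x - k * w t by rewrite (Defs.valM w_val) // valuation_exprz // mulNr.
have wy' : w y = (w x %% w t)%Z by rewrite wy /modz.
have lt : (w x %% w t)%Z < w t by apply: ltz_pmod.
have ge : 0 <= (w x %% w t)%Z by apply: modz_ge0; lia.
have := min y yF y0; rewrite wy'; move: wy; rewrite wy'; lia.
Qed.

Lemma uniformizer_val F t t' : uniformizer w F t -> uniformizer w F t' -> w t = w t'.
Proof.
move=> [tF t0 wt min] [tF' t0' wt' min']; apply/eqP.
by rewrite eq_le min ?min'.
Qed.

Lemma pidealE F t i x : uniformizer w F t ->
  pideal w F i x <-> x \in F /\ vge w (i * w t) x.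
Proof.
move=> ut; split=> [[xF [t' ut']]|[xF h]]; first by rewrite (uniformizer_val ut ut').
by split=> //; exists t.
Qed.

(* The powers b^j (0 <= j < d) have valuations distinct modulo those of F. *)
Definition separated F b d :=
  forall j : nat, (0 < j < d)%N -> forall a, a \in F -> a != 0 -> w a != j%:Z * w b.

(** The nonzero terms of [P.[b]] have distinct valuations: an equality would give a quotient of two
    coefficients the valuation of [b ^+ j] with [0 < j < d]. *)
Lemma separated_orthogonal F b d (P : {poly N}) i : b != 0 -> separated F b d ->
  P \is a polyOver F -> (size P <= d)%N -> vge w i P.[b] ->
  forall j, vge w i (P`_j * b ^+ j).
Proof.
move=> b0 sep PF sP; rewrite (horner_coef_wide _ sP) => h j.
have [jd|dj] := ltnP j d; last first.
  by rewrite nth_default ?mul0r ?vge0 //; apply: leq_trans dj.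
apply: (vge_sum_distinct w_val _ h (Ordinal jd)) => {j jd} j k jk.
wlog lt : j k jk / (j < k)%N.
  move=> W hj hk; move: (jk); rewrite -(inj_eq val_inj) neq_ltn => /orP[lt|lt].
    exact: W.
  by rewrite eq_sym; apply: W => //; rewrite eq_sym.
rewrite !mulf_eq0 !expf_eq0 !(negbTE b0) !andbF !orbF => Pj Pk.
have bn0 m : b ^+ m != 0 by rewrite expf_neq0.
apply/eqP; rewrite !(Defs.valM w_val) // !valuationX // => e.
have := sep (k - j)%N _ (P`_j / P`_k).
rewrite subn_gt0 lt (leq_ltn_trans (leq_subr _ _) (ltn_ord k)) => /(_ isT).
rewrite memvM ?memvV ?(polyOverP PF) // mulf_neq0 ?invr_eq0 // => /(_ isT isT)/eqP; apply.
rewrite (Defs.valM w_val) ?invr_eq0 // valuationV //.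
rewrite -subzn ?(ltnW lt) // mulrBl; move: e.
by move: (w P`_j) (w P`_k) (_ * _) (_ * _) => A B C D; lia.
Qed.

(** Were the degree smaller, the terms of the minimal polynomial at [b] could not cancel, and its
    leading term [b ^+ adjoin_degree F b] would vanish. *)
Lemma separated_degree F b d : b != 0 -> separated F b d -> (d <= adjoin_degree F b)%N.
Proof.
move=> b0 sep; rewrite leqNgt; apply/negP => lt.
have h k := @separated_orthogonal F b d (minPoly F b) k%:Z b0 sep (minPolyOver F b).
have sz := size_minPoly F b; rewrite sz in h.
have := monic_minPoly F b; rewrite monicE lead_coefE sz /= => /eqP lc.
have : (1 : N) * b ^+ adjoin_degree F b = 0.
  apply: (vge_eq0 (v := w)) => k; rewrite -lc.
  by apply: h => //; rewrite minPolyxx vge0.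
by move/eqP; rewrite mul1r (negbTE (expf_neq0 _ b0)).
Qed.

Lemma adjoin_degree_le F b (P : {poly N}) : P \is a polyOver F -> P != 0 -> root P b ->
  (adjoin_degree F b < size P)%N.
Proof.
move=> PF P0 Pb; rewrite -size_minPoly.
by apply: dvdp_leq => //; apply: minPoly_dvdp.
Qed.

Lemma separated_val F b x : b != 0 -> separated F b (adjoin_degree F b) ->
  x \in <<F; b>>%VS -> x != 0 ->
  exists a (j : nat), [/\ a \in F, a != 0, (j < adjoin_degree F b)%N &
    w x = w a + j%:Z * w b].
Proof.
move=> b0 sep xFb x0; set d := adjoin_degree F b in sep *.
have ex := Fadjoin_poly_eq xFb; set P := Fadjoin_poly F b x in ex.
have PF : P \is a polyOver F by apply: Fadjoin_polyOver.
have sP : (size P <= d)%N by apply: size_Fadjoin_poly.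
have all_ge := separated_orthogonal b0 sep PF sP.
have [j hj] : exists j : 'I_d, ~~ vge w (w x + 1) (P`_j * b ^+ j).
  apply/existsP; rewrite -negb_forall; apply/negP => /forallP h.
  have : vge w (w x + 1) x.
    by rewrite -{2}ex (horner_coef_wide _ sP); apply: vge_sum => // j _; apply: h.
  by rewrite vgeE //; lia.
have := all_ge (w x) _ j; rewrite ex vge_val // => /(_ isT) ge.
have Pb0 : P`_j * b ^+ j != 0 by apply: contraNneq hj => ->; apply: vge0.
have := Pb0; rewrite mulf_eq0 negb_or => /andP[Pj bj].
exists P`_j, j; split=> //; first exact: (polyOverP PF).
move: ge hj; rewrite !vgeE // (Defs.valM w_val) // valuationX //.
set A := w P`_j; set B := (j%:Z * w b); move=> h1 h2; lia.
Qed.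

End Subextensions.

Section Ramification.
Variables (p : nat) (K : fieldType) (v : K -> int) (N : splittingFieldType K) (w : N -> int).
Hypothesis p_prime : prime p.
Hypothesis K_pfield : p_field p v.
Hypothesis N_galois : galois 1%AS {:N}%AS.
Hypothesis w_val : normalized_valuation w.
Hypothesis w_ext : extends_valuation v w.
Implicit Types (F E L M : {subfield N}) (x y t b : N).

Let v_val := pfield_val K_pfield.
Let v_complete := pfield_complete K_pfield.
Let vge_autN := vge_aut v_complete w_val w_ext.
Notation tame := (tame_root p).

Lemma galois_over F : galois F {:N}%AS.
Proof. by apply: galoisS N_galois; rewrite sub1v subvf. Qed.

Lemma mem_galois_fixed F x : (forall z, z \in 'Gal({:N} / F)%g -> z x = x) -> x \in F.
Proof.
have /galois_fixedField eF := galois_over F.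
by move=> h; rewrite -eF; apply/fixedFieldP; rewrite ?memvf.
Qed.

Lemma field_uniformizer F : exists t, uniformizer w F t.
Proof.
apply: uniformizer_exists => //.
have [c c0 vc] := val_unif v_val; have [e e0 we] := w_ext.
exists c%:A; first by rewrite memvZ ?mem1v.
by rewrite scaler_eq0 negb_or c0 oner_neq0 we // vc; lia.
Qed.

(** Argument in the manner of Krasner: a conjugate of [o] over [F] is again a tame root congruent to
    [x], hence to [o], hence equal to [o]. *)
Lemma tame_root_mem F o x : tame o -> x \in F -> vge w 1 (x - o) -> o \in F.
Proof.
move=> to xF xo; apply: mem_galois_fixed => z zG.
apply: (tame_root_congr p_prime K_pfield N_galois w_val w_ext (tame_root_aut z to) to).
have : vge w 1 (z (x - o)) by rewrite vge_autN.
rewrite rmorphB /= (fixed_gal (subvf F) zG xF) vgeBC // => h.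
exact: vge_trans h xo.
Qed.

(** Each element of [E] has a leading digit [o * s ^ a * t ^+ j] with [j < e], and [o] lies in [K]
    by hypothesis, so the digit is a [K]-multiple of [t ^+ j]. Iteration approximates the element by
    the span of these [e] powers, which is closed. *)
Lemma totally_ramified_adjoin E s t (e : nat) :
  uniformizer w 1%AS s -> uniformizer w E t -> w s = e%:Z * w t ->
  (forall o, tame o -> o \in E -> o \in 1%AS) ->
  \dim E = e /\ <<1; t>>%VS = E.
Proof.
move=> us ut wse noE.
have [sK s0 ws _] := us; have [tE t0 wt _] := ut.
have e0 : (0 < e)%N by case: e wse => // e0; rewrite e0 mul0r in ws.
have sE : s \in E by apply: subvP sK; apply: sub1v.
pose V := <<[seq (t ^+ j)%R | j <- iota 0 e]>>%VS.
have approx1 x : x \in E -> exists y, [/\ y \in V, y \in E & vge w (w x + 1) (x - y)].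
  move=> xE; have [->|x0] := eqVneq x 0.
    by exists 0; rewrite !mem0v subrr vge0.
  have [k wx] := uniformizer_dvd w_val ut xE x0.
  have [a [j [je kE]]] := int_euclid k e0.
  pose c := s ^ a * t ^+ j.
  have sa0 : s ^ a != 0 by rewrite expfz_neq0.
  have c0 : c != 0 by rewrite mulf_neq0 ?expf_neq0.
  have cE : c \in E by rewrite memvM ?memv_exprz ?rpredX.
  have wc : w c = w x.
    rewrite (Defs.valM w_val) ?expf_neq0 // valuation_exprz // valuationX //.
    by rewrite wx kE wse mulrDl mulrA.
  have xcE : x / c \in E by rewrite memvM ?memvV.
  have [||o to xo] := teichmuller p_prime K_pfield N_galois w_val w_ext (x := x / c).
  - by rewrite mulf_neq0 ?invr_eq0.
  - by rewrite (Defs.valM w_val) ?invr_eq0 // valuationV // wc subrr.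
  have oE := tame_root_mem to xcE xo.
  exists (o * c); split; last first.
  - have -> : x - o * c = c * (x / c - o).
      by rewrite [c * _]mulrC mulrBl divfK.
    by rewrite -wc vge_pmul.
  - by rewrite memvM.
  rewrite /c mulrA; have /vlineP[k1 ->] : o * s ^ a \in 1%AS.
    by rewrite memvM ?(noE _ to oE) ?memv_exprz.
  rewrite mulr_algl memvZ // memv_span //; apply/mapP; exists j => //.
  by rewrite mem_iota.
have approx (k : nat) i x : x \in E -> vge w i x ->
    exists y, [/\ y \in V, y \in E & vge w (i + k%:Z) (x - y)].
  elim: k i x => [|k IH] i x xE hx.
    by exists 0; rewrite !mem0v !subr0.
  have [y [yV yE hy]] := approx1 x xE.
  have [->|x0] := eqVneq x 0; first by exists 0; rewrite !mem0v subrr vge0.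
  have xyE : x - y \in E by rewrite memvB.
  have [|y' [yV' yE' hy']] := IH (i + 1) _ xyE.
    by apply: vge_le hy; rewrite lerD2r -(vgeE w) //.
  exists (y + y'); split; rewrite ?memvD //.
  by rewrite opprD (addrA x) intS (addrA i).
have EV : (E <= V)%VS.
  apply/subvP => x xE; apply: (vspace_closed v_complete w_val w_ext) => i.
  have [y [yV _ hy]] := approx `|i - w x|%N (w x) x xE (vge_val (lexx _)).
  by exists y => //; apply: vge_le hy; rewrite abszE -lerBlDl ler_norm.
have dV : (\dim V <= e)%N.
  by apply: leq_trans (dim_span _) _; rewrite size_map size_iota.
have sep : separated w 1%AS t e.
  move=> j /andP[j0 je] a aK a0; have [k ->] := uniformizer_dvd w_val us aK a0.
  rewrite wse mulrA; apply/eqP => /mulIf -/(_ (lt0r_neq0 wt))/dvdn_intmul.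
  by move/(dvdn_leq j0); rewrite leqNgt je.
have tE' : (<<1; t>> <= E)%VS by rewrite sub_adjoin1v.
have d1 := separated_degree w_val t0 sep.
have d2 := dim_Fadjoin 1%AS t; rewrite dimv1 muln1 in d2.
have d3 := dimvS tE'; have d4 := dimvS EV.
have dE : \dim E = e by apply/eqP; rewrite eqn_leq (leq_trans d4 dV) (leq_trans _ d3) // d2.
by split=> //; apply/eqP; rewrite eqEdim tE' dE d2.
Qed.

(** A tame root of [E] outside [K] would generate [E] by primitivity; then [t] would have the
    valuation of an element of [K], against ramification. *)
Lemma wild_totally_ramified E s t n : wildly_primitive w p E -> \dim E = (p ^ n)%N ->
  uniformizer w 1%AS s -> uniformizer w E t ->
  w s = (p ^ n)%:Z * w t /\ <<1; t>>%VS = E.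
Proof.
move=> [[_ prim] _ [e [s' [t' [us' ut' wst]]] e1]] dE us ut.
have {}wst : w s = e%:Z * w t.
  by rewrite (uniformizer_val us us') wst (uniformizer_val ut' ut).
have [|d <-] := totally_ramified_adjoin us ut wst; last by rewrite wst -d dE.
move=> o to oE; apply/negPn/negP => oK.
have /prim /orP[/eqP e1E|/eqP eE] : (<<1; o>>%AS <= E)%VS by rewrite sub_adjoin1v.
  by move: oK; rewrite -[1%AS : {vspace _}]e1E memv_adjoin.
have [tE t0 wt _] := ut.
have [|a [aK a0 wa]] := unramified_adjoin p_prime K_pfield N_galois w_val w_ext (F := 1%AS) to (x := t) _ t0.
  by rewrite eE.
have [_ _ _ min] := us; have := min a aK a0; rewrite wa => /(_ wt).
by rewrite wst; move: wt e1; clear; nia.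
Qed.

End Ramification.

(** * The tame extension obtained by adjoining all [e]-th roots *)

Section TameClosure.
Variables (p : nat) (K : fieldType) (v : K -> int) (N : splittingFieldType K) (w : N -> int).
Hypothesis p_prime : prime p.
Hypothesis K_pfield : p_field p v.
Hypothesis N_galois : galois 1%AS {:N}%AS.
Hypothesis w_val : normalized_valuation w.
Hypothesis w_ext : extends_valuation v w.
Implicit Types (F E L M : {subfield N}) (x y t b : N).

Let v_complete := pfield_complete K_pfield.
Let vge_autN := vge_aut v_complete w_val w_ext.
Let w_p := vge_p K_pfield w_ext.
Notation tame := (tame_root p).

Lemma adjoin_roots_root F (P : {poly N} -> Prop) L q : adjoin_roots F P L -> P q ->
  (1 < size q)%N -> exists2 r, r \in L & root q r.
Proof.
move=> [_ spl _] Pq sq; have [rs eq_rs rsL] := spl q Pq.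
case: rs eq_rs rsL => [|r rs] eq_rs rsL.
  by have := eqp_size eq_rs; rewrite big_nil size_poly1 => e; rewrite e in sq.
exists r; first by apply: rsL; rewrite mem_head.
by rewrite (eqp_root eq_rs) root_prod_XsubC mem_head.
Qed.

Lemma root_XnsubC (d : nat) (x r : N) : root ('X^d - x%:P) r = (r ^+ d == x).
Proof. by rewrite rootE !hornerE subr_eq0. Qed.

Variables (e : nat) (s zeta : N) (L : {subfield N}).
Hypothesis pe : ~~ (p %| e)%N.
Hypothesis us : uniformizer w 1%AS s.
Hypothesis zeta_root : zeta ^+ e = 1.
Hypothesis L_def : adjoin_all_radicals e <<1; zeta>>%AS L.

Let e0 : (0 < e)%N.
Proof. by case: e pe; rewrite ?dvdn0. Qed.

Lemma tame_uniformizer_root : exists2 u, u \in L & u ^+ e = s.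
Proof.
have [sK s0 _ _] := us.
have [||u uL] := adjoin_roots_root (q := 'X^e - s%:P) L_def.
- by exists s; split=> //; apply: subvP sK; apply: sub1v.
- by rewrite size_XnsubC.
by rewrite root_XnsubC => /eqP; exists u.
Qed.

Variable u : N.
Hypothesis uL : u \in L.
Hypothesis us_e : u ^+ e = s.

Lemma tame_uniformizer_neq0 : u != 0.
Proof.
have [_ s0 _ _] := us; apply: contraNneq s0 => u0.
by rewrite -us_e u0 expr0n gtn_eqF.
Qed.

Lemma tame_uniformizer_val : w s = e%:Z * w u.
Proof. by rewrite -us_e valuationX ?tame_uniformizer_neq0. Qed.

(** An [e]-th root [r] of an element of [K(zeta)] is [y * o * u ^ a] with [o] a tame root and [y] a
    1-unit; the exponent [a] exists because [K(zeta)] has the same values as [K]. As [y ^+ e] lies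
    in [F'] and [p] does not divide [e], every automorphism over [F'] fixes [y]. *)
Lemma tame_closure_sub F (F' : {subfield N}) : (F <= F')%VS ->
  (forall o, tame o -> o \in F') -> (L <= <<F'; u>>)%VS.
Proof.
move=> FF' tF'; have [KL spl min] := L_def.
have u0 := tame_uniformizer_neq0.
have zt : tame zeta by exists e.
have KF' : (<<1; zeta>> <= F')%VS by rewrite sub_adjoin1v tF'.
apply: min => [|_ [x [xK x0 ->]]]; first exact: subv_trans KF' (subv_adjoin _ _).
have [|rs eq_rs rsL] := spl ('X^e - x%:P); first by exists x.
exists rs => // r rrs.
have rx : r ^+ e = x.
  by apply/eqP; rewrite -root_XnsubC (eqp_root eq_rs) root_prod_XsubC.
have r0 : r != 0 by apply: contraNneq x0 => r0; rewrite -rx r0 expr0n gtn_eqF.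
have [b [bK b0 wb]] :=
  unramified_adjoin p_prime K_pfield N_galois w_val w_ext zt xK x0.
have [a wa] := uniformizer_dvd w_val us bK b0.
have wr : w r = a * w u.
  have : e%:Z * w r = e%:Z * (a * w u).
    by rewrite -valuationX // rx -wb wa tame_uniformizer_val mulrCA.
  by apply: mulfI; rewrite (eqz_nat e 0) -lt0n.
have ua0 : u ^ a != 0 by rewrite expfz_neq0.
pose r1 := r / u ^ a.
have r10 : r1 != 0 by rewrite mulf_neq0 ?invr_eq0.
have wr1 : w r1 = 0.
  by rewrite (Defs.valM w_val) ?invr_eq0 // valuationV // valuation_exprz // wr subrr.
have [o to r1o] := teichmuller p_prime K_pfield N_galois w_val w_ext r10 wr1.
have [o0 wo] := tame_root_val p_prime N_galois w_val to.
pose y := r1 / o.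
have y0 : y != 0 by rewrite mulf_neq0 ?invr_eq0.
have y1 : vge w 1 (y - 1).
  rewrite -(@vge_pmul _ _ w_val _ o) // wo add0r mulrBr mulr1 mulrC divfK //.
have yF' : y \in F'.
  apply: (mem_galois_fixed N_galois) => z zG.
  have zy1 : vge w 1 (z y - 1).
    by rewrite -[1 in X in vge _ _ X](rmorph1 z) -rmorphB /= vge_autN.
  have yeF : y ^+ e \in F'.
    have -> : y ^+ e = x / (s ^ a * o ^+ e).
      have ua : (u ^ a) ^+ e = s ^ a by rewrite exprnP exprzAC -exprnP us_e.
      by rewrite /y /r1 !expr_div_n rx ua -mulrA -invfM.
    have [sK _ _ _] := us.
    apply: memvM; first exact: (subvP KF').
    rewrite memvV; apply: memvM; last by apply: rpredX; apply: tF'.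
    by apply: memv_exprz; apply: (subvP (sub1v F')).
  apply: (divIf y0); rewrite divff //.
  apply: (unity_root_eq1 w_val p_prime w_p _ pe).
    have [_ wy] := valuation1_unit w_val y1.
    rewrite -(@vge_pmul _ _ w_val _ y) // wy add0r mulrBr mulr1 mulrC divfK //.
    by apply: (@vge_trans _ _ w_val _ 1) => //; rewrite vgeBC.
  rewrite expr_div_n -rmorphXn /= (fixed_gal (subvf F') zG yeF) divff //.
  by rewrite expf_neq0.
have -> : r = y * o * u ^ a by rewrite divfK // divfK.
have FF := subvP (subv_adjoin F' u).
apply: memvM; last by apply: memv_exprz; apply: memv_adjoin.
by apply: memvM; apply: FF => //; apply: tF'.
Qed.

(** Replacing [F] by the extension [F'] with all tame roots and the same values reduces the
    compositum to the adjunction of [u]. The divisibility hypothesis says that [j * w u] is not a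
    value of [F] for [0 < j < e], so the powers of [u] are separated over [F']. *)
Lemma tame_closure_val F x :
  (forall a (j : nat), a \in F -> a != 0 -> w a = j%:Z * w u -> (e %| j)%N) ->
  x \in (F * L)%VS -> x != 0 ->
  exists a (j : nat), [/\ a \in F, a != 0 & w x = w a + j%:Z * w u].
Proof.
move=> dv xFL x0; have u0 := tame_uniformizer_neq0.
have [F' [FF' tF' vF']] := max_unramified p_prime K_pfield N_galois w_val w_ext F.
have LF' := tame_closure_sub FF' tF'.
have FLF' : (F * L <= <<F'; u>>)%VS.
  rewrite -[X in (_ <= X)%VS]prodv_id prodvS //.
  exact: subv_trans FF' (subv_adjoin _ _).
have xF' := subvP FLF' _ xFL.
have sep : separated w F' u e.
  move=> j /andP[j0 je] a aF' a0; apply/negP => /eqP wa.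
  have [b [bF b0 wb]] := vF' a aF' a0.
  by have := dv b j bF b0; rewrite wb wa => /(_ erefl) /(dvdn_leq j0); rewrite leqNgt je.
have dF' : adjoin_degree F' u = e.
  apply/eqP; rewrite eqn_leq (separated_degree w_val u0 sep) andbT -ltnS.
  have [sK s0 _ _] := us.
  have sF' : s \in F' by apply: subvP sK; apply: sub1v.
  rewrite -(size_XnsubC s e0); apply: adjoin_degree_le.
  - by rewrite rpredB ?polyOverXn ?polyOverC.
  - by rewrite -size_poly_eq0 size_XnsubC.
  - by rewrite root_XnsubC us_e.
rewrite -dF' in sep.
have [a [j [aF' a0 _ wx]]] := separated_val w_val u0 sep xF' x0.
by have [b [bF b0 wb]] := vF' a aF' a0; exists b, j; rewrite wb.
Qed.

Lemma tame_closure_uniformizer : uniformizer w L u.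
Proof.
have [_ s0 ws min] := us; have wsu := tame_uniformizer_val.
have u0 := tame_uniformizer_neq0.
have wu : 0 < w u by move: ws; rewrite wsu pmulr_rgt0 // ltz_nat.
split=> // x xL x0 wx.
have [||a [j [aK a0 wxa]]] := @tame_closure_val 1%AS x _ _ x0.
- move=> a j aK a0; have [k ->] := uniformizer_dvd w_val us aK a0.
  rewrite wsu mulrA => /mulIf -/(_ (lt0r_neq0 wu)).
  exact: dvdn_intmul.
- by rewrite prod1v.
have [k wk] := uniformizer_dvd w_val us aK a0.
move: wx; rewrite wxa wk wsu mulrA -mulrDl pmulr_lgt0 // => h.
by rewrite -[w u in X in X <= _]mul1r ler_pM2r // -gtz0_ge1.
Qed.

End TameClosure.

(** * Totally ramified extensions and the effect of the break on [Pi] *)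

Section TotallyRamified.
Variables (K : fieldType) (N : splittingFieldType K) (w : N -> int).
Hypothesis w_val : normalized_valuation w.
Hypothesis w_aut : forall (f : 'AEnd(N)) x, w (f x) = w x.
Implicit Types (F E : {subfield N}) (x y t b : N).

Lemma pge_hornerB (P : {poly N}) i x y : pge w 0 P -> vge w 0 x -> vge w 0 y ->
  vge w i (x - y) -> vge w i (P.[x] - P.[y]).
Proof.
move=> P0 x0 y0 h; rewrite !horner_coef -sumrB; apply: vge_sum => // j _.
rewrite -mulrBr subrXX; apply: vge0M => //; apply: vgeM0 => //.
by apply: vge_sum => // k _; apply: vge0M => //; apply: vge0X.
Qed.

Variables (L M : {subfield N}) (u Pi : N) (q : nat).
Hypothesis q0 : (0 < q)%N.
Hypothesis uu : uniformizer w L u.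
Hypothesis uPi : uniformizer w M Pi.
Hypothesis w_u : w u = q%:Z * w Pi.
Hypothesis M_gen : <<L; Pi>>%VS = M.
Hypothesis M_deg : adjoin_degree L Pi = q.

Let Pi0 : Pi != 0. Proof. by case: uPi. Qed.
Let wPi : 0 < w Pi. Proof. by case: uPi. Qed.
Let Pi_int : vge w 0 Pi. Proof. by rewrite vge_val ?ltW. Qed.

Lemma totally_ramified_separated : separated w L Pi q.
Proof.
move=> j /andP[j0 jq] a aL a0; have [k ->] := uniformizer_dvd w_val uu aL a0.
rewrite w_u mulrA; apply/eqP => /mulIf -/(_ (lt0r_neq0 wPi))/dvdn_intmul.
by move/(dvdn_leq j0); rewrite leqNgt jq.
Qed.

Lemma totally_ramified_expansion x (P := Fadjoin_poly L Pi x) : x \in M ->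
  [/\ P \is a polyOver L, (size P <= q)%N, P.[Pi] = x &
    forall i, vge w i x -> forall j, vge w i (P`_j * Pi ^+ j)].
Proof.
rewrite -{1}M_gen => xM; have ex := Fadjoin_poly_eq xM; rewrite -/P in ex.
have PL : P \is a polyOver L by apply: Fadjoin_polyOver.
have sP : (size P <= q)%N by rewrite -M_deg; apply: size_Fadjoin_poly.
split=> // i hx.
apply: (separated_orthogonal w_val Pi0 totally_ramified_separated PL sP).
by rewrite ex.
Qed.

(** This is [O_M = O_L[Pi]]: the terms cannot cancel, and [Pi ^+ j] with [j < q] is too small to
    compensate a pole of a coefficient, whose valuation is a multiple of [q * w Pi]. *)
Lemma totally_ramified_integral x : x \in M -> vge w 0 x ->
  pge w 0 (Fadjoin_poly L Pi x).
Proof.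
move=> xM x0; have [PL sP eP hP] := totally_ramified_expansion xM.
move: PL sP eP hP; set P := Fadjoin_poly L Pi x => PL sP eP hP.
move=> j; have [jq|qj] := ltnP j q; last first.
  by rewrite nth_default ?vge0 //; apply: leq_trans qj.
have [->|Pj] := eqVneq P`_j 0; first exact: vge0.
have PjL : P`_j \in L by apply: (polyOverP PL).
have := hP 0 x0 j; have [k wk] := uniformizer_dvd w_val uu PjL Pj.
have ej := expf_neq0 j Pi0.
rewrite !vgeE ?mulf_neq0 // (Defs.valM w_val) // valuationX // wk w_u mulrA -mulrDl.
rewrite !pmulr_lge0 //; move: jq; clear; nia.
Qed.

(** The residue field does not grow: in the expansion of [x], only the constant term can have a
    valuation that is a multiple of [w u]. *)
Lemma totally_ramified_residue x k : x \in M -> x != 0 -> w x = k * w u ->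
  exists2 l, l \in L & vge w (w x + 1) (x - l).
Proof.
move=> xM x0 wx; have [PL sP eP hP] := totally_ramified_expansion xM.
move: PL sP eP hP; set P := Fadjoin_poly L Pi x => PL sP eP hP.
exists P`_0; first exact: (polyOverP PL).
rewrite -[in x - _]eP (horner_coef_wide _ sP) (bigD1 (Ordinal q0)) //= expr0 mulr1.
rewrite addrAC subrr add0r; apply: vge_sum => // -[j jq] /=.
rewrite -(inj_eq val_inj) /= -lt0n => j0.
have := hP _ (vge_val (lexx (w x))) j.
have [->|Pj] := eqVneq P`_j 0; first by rewrite mul0r !vge0.
have PjL : P`_j \in L by apply: (polyOverP PL).
have ej := expf_neq0 j Pi0.
have [m wm] := uniformizer_dvd w_val uu PjL Pj.
rewrite !vgeE ?mulf_neq0 // (Defs.valM w_val) // valuationX // wm => le.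
rewrite lezD1 lt_neqAle le andbT; apply/eqP; rewrite wx w_u !mulrA -mulrDl.
move/mulIf => /(_ (lt0r_neq0 wPi)) e.
have : (k - m) * q%:Z = j%:Z by rewrite mulrBl e addrAC subrr add0r.
by move/dvdn_intmul/(dvdn_leq j0); rewrite leqNgt jq.
Qed.

Variable gamma : int.
Hypothesis gamma_break : ramification_break w M L gamma.

Lemma break_integral (g : gal_of M) x : g \in 'Gal(M / L)%g -> x \in M -> vge w 0 x ->
  vge w ((gamma + 1) * w Pi) (g x - x).
Proof.
move=> gG xM x0; have [h _] := gamma_break.
have := h g gG x; rewrite !(pidealE _ _ uPi) mul0r.
by case/(_ (conj xM x0)).
Qed.

(** Since [O_M = O_L[Pi]], a congruence between [g Pi] and [Pi] extends to all integral elements; a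
    larger valuation would put [g] into the next ramification group, which is trivial. *)
Lemma break_uniformizer (g : gal_of M) : g \in 'Gal(M / L)%g -> g != 1%g ->
  g Pi - Pi != 0 /\ w (g Pi - Pi) = (gamma + 1) * w Pi.
Proof.
move=> gG g1; have [PiM _ _ _] := uPi.
have LM : (L <= M)%VS by rewrite -M_gen subv_adjoin.
have gePi := break_integral gG PiM Pi_int.
have gPi_int : vge w 0 (g Pi).
  by rewrite /vge w_aut fmorph_eq0.
have nge : vge w ((gamma + 2) * w Pi) (g Pi - Pi) = false.
  apply/negP => h; move/eqP: g1; apply; have [_] := gamma_break; apply=> // x.
  rewrite !(pidealE _ _ uPi) mul0r => -[xM x0]; split.
    by rewrite memvB ?memv_gal.
  have [PL _ eP _] := totally_ramified_expansion xM.
  have P0 := totally_ramified_integral xM x0; move: PL eP P0.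
  set P := Fadjoin_poly L Pi x => PL <- P0.
  have -> : g P.[Pi] = P.[g Pi].
    by rewrite -horner_map /= (fixedPoly_gal LM gG).
  rewrite -addrA; exact: pge_hornerB.
have gP0 : g Pi - Pi != 0 by apply: contraFneq nge => ->; apply: vge0.
split=> //; move: gePi nge; rewrite !vgeE //.
have [k ->] : exists k, w (g Pi - Pi) = k * w Pi.
  by apply: (uniformizer_dvd w_val uPi) => //; rewrite memvB ?memv_gal.
rewrite !ler_pM2r // => h1 /negbT h2; congr (_ * _); move: h1 h2; clear; lia.
Qed.

End TotallyRamified.

(** That [p] does not divide [j] is recorded because [g] must move [b ^+ j] to the same relative
    order as [b]. *)
Lemma prime_bezout (p : nat) (k : int) : prime p -> ~~ (p %| `|k|)%N ->
  exists (j : nat) (m : int), j%:Z * k + p%:Z * m = 1 /\ ~~ (p %| j)%N.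
Proof.
move=> pp pk; have p0 := prime_gt0 pp; have p1 := prime_gt1 pp.
have [[a b] e] : exists ab : int * int, ab.1 * k + ab.2 * p%:Z = 1.
  have [a [b e]] := Bezoutz k p%:Z; exists (a, b); rewrite /= e.
  have : coprimez k p%:Z by rewrite /coprimez /gcdz absz_nat eqz_nat -/(coprime _ _) coprime_sym prime_coprime.
  by move/eqP.
have [c [j [jp ea]]] := int_euclid a p0.
exists j, (b + c * k); rewrite /= ea in e; split; first by rewrite -[RHS]e; ring.
apply/negP => /dvdnP[i ei].
have : (p%:Z %| 1)%Z.
  by apply/dvdzP; exists (c * k + i%:Z * k + b); rewrite -[LHS]e ei PoszM; ring.
by rewrite dvdz1 absz_nat => /eqP; lia.
Qed.

(** * Descent of the break to a subextension of degree [p] *)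

Section SubextensionBreak.
Variables (K : fieldType) (N : splittingFieldType K) (w : N -> int).
Hypothesis w_val : normalized_valuation w.
Hypothesis w_aut : forall (f : 'AEnd(N)) x, w (f x) = w x.

Let vge_autN (f : 'AEnd(N)) i x : vge w i (f x) = vge w i x.
Proof. by rewrite /vge w_aut fmorph_eq0. Qed.

Lemma pge_div_prod_XsubC (rs : seq N) (H : {poly N}) : uniq rs ->
  (forall r, r \in rs -> vge w 0 r) -> pge w 0 H ->
  (forall r, r \in rs -> root H r) ->
  exists2 q, H = q * \prod_(r <- rs) ('X - r%:P) & pge w 0 q.
Proof.
elim: rs H => [|r rs IH] H /=.
  by move=> _ _ H0 _; exists H; rewrite // big_nil mulr1.
move=> /andP[rrs urs] rs0 H0 Hr.
have [q eH _] := divXsubC H r.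
have rin : r \in r :: rs by rewrite mem_head.
have Hr0 : H.[r] = 0 by apply/rootP/Hr.
rewrite Hr0 addr0 in eH.
have q0 : pge w 0 q by apply: (pge_divXsubC w_val (rs0 r rin)); rewrite -eH.
have [||q' eq q'0] := IH q urs _ q0.
- by move=> s hs; apply: rs0; rewrite inE hs orbT.
- move=> s hs; have : root H s by apply: Hr; rewrite inE hs orbT.
  rewrite eH rootM root_XsubC => /orP[//|/eqP sr].
  by rewrite -sr hs in rrs.
by exists q' => //; rewrite big_cons eH eq mulrAC mulrA.
Qed.

Variables (L M : {subfield N}) (u Pi : N) (p q' : nat).
Hypothesis p_prime : prime p.
Hypothesis w_p : vge w 1 p%:R.
Hypothesis q'0 : (0 < q')%N.
Hypothesis uu : uniformizer w L u.
Hypothesis uPi : uniformizer w M Pi.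
Hypothesis w_u : w u = (p * q')%N%:Z * w Pi.
Hypothesis M_gen : <<L; Pi>>%VS = M.
Hypothesis M_deg : adjoin_degree L Pi = (p * q')%N.
Hypothesis M_galois : galois L M.
Variable gamma : int.
Hypothesis gamma_break : ramification_break w M L gamma.

Variables (b : N) (k delta : int) (g : gal_of M).
Hypothesis bM : b \in M.
Hypothesis b0 : b != 0.
(** The valuation of a uniformizer of [L(b)]: [delta] is measured in this unit, [gamma] in units of
    [w Pi]. *)
Variable W : int.
Hypothesis W_def : W = q'%:Z * w Pi.
Hypothesis w_b : w b = k * W.
Hypothesis pk : ~~ (p %| `|k|)%N.
Hypothesis b_deg : (adjoin_degree L b <= p)%N.
Hypothesis gG : g \in 'Gal(M / L)%g.
Hypothesis gb : g b != b.
Hypothesis w_gb : w (g b / b - 1) = delta * W.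
Hypothesis delta_gt0 : 0 < delta.

Let wPi : 0 < w Pi. Proof. by case: uPi. Qed.
Let W0 : 0 < W. Proof. by rewrite W_def mulr_gt0 // ltz_nat. Qed.
Let Pi_int : vge w 0 Pi. Proof. by rewrite vge_val ?ltW. Qed.
Let PiM : Pi \in M. Proof. by case: uPi. Qed.
Let LM : (L <= M)%VS. Proof. by rewrite -M_gen subv_adjoin. Qed.
Let w_uW : w u = p%:Z * W. Proof. by rewrite w_u PoszM W_def mulrA. Qed.
Let pq0 : (0 < p * q')%N. Proof. by rewrite muln_gt0 prime_gt0. Qed.
Let M1 := <<L; b>>%AS.
Let M1M : (M1 <= M)%VS. Proof. exact/FadjoinP. Qed.
Let y := g b / b.
Let y1 : vge w (delta * W) (y - 1). Proof. by rewrite vge_val ?w_gb. Qed.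
Let y1' : vge w 1 (y - 1).
Proof. by apply: vge_le y1; rewrite -gtz0_ge1 mulr_gt0. Qed.

Lemma subext_separated : separated w L b p.
Proof.
move=> j /andP[j0 jp] a aL a0; have [m ->] := uniformizer_dvd w_val uu aL a0.
rewrite w_b w_uW !mulrA; apply/eqP => /mulIf -/(_ (lt0r_neq0 W0)) /(congr1 absz).
rewrite !abszM !absz_nat => e.
have : (p %| j * `|k|)%N by rewrite -e dvdn_mull.
by rewrite Euclid_dvdM // (negbTE pk) orbF => /(dvdn_leq j0); rewrite leqNgt jp.
Qed.

Lemma subext_degree : adjoin_degree L b = p.
Proof.
by apply/eqP; rewrite eqn_leq b_deg (separated_degree w_val b0 subext_separated).
Qed.

(** The terms of the expansion of [c] in powers of [b] are integral. For [0 < j < p] a nonzero term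
    has valuation a multiple of [W], nonzero since [p] does not divide [j * k]; this positive
    valuation supplies the 1 in [delta + 1]. *)
Lemma subext_break_ge c : c \in M1 -> vge w 0 c -> vge w ((delta + 1) * W) (g c - c).
Proof.
move=> cM1 c0; have ec := Fadjoin_poly_eq cM1; set P := Fadjoin_poly L b c in ec.
have PL : P \is a polyOver L by apply: Fadjoin_polyOver.
have sP : (size P <= p)%N by rewrite -subext_degree; apply: size_Fadjoin_poly.
have hP := separated_orthogonal w_val b0 subext_separated PL sP.
have {}hP := hP 0 _; rewrite ec in hP; have {}hP := hP c0.
have -> : g c - c = \sum_(j < p) P`_j * b ^+ j * (y ^+ j - 1).
  rewrite -{1 2}ec -horner_map /= (fixedPoly_gal LM gG PL).
  rewrite !(horner_coef_wide _ sP) -sumrB; apply: eq_bigr => j _.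
  rewrite /y expr_div_n mulrBr mulr1 -[P`_j * _ * _]mulrA; congr (_ * _ - _).
  by rewrite mulrC divfK // expf_neq0.
apply: vge_sum => // -[[|j] jp] _ /=; first by rewrite !expr0 subrr mulr0 vge0.
have yj : vge w (delta * W) (y ^+ j.+1 - 1).
  by apply: vge_subX1 => //; apply: vge1_unit y1'.
rewrite mulrDl mul1r addrC; apply: vgeM => //.
have [->|Pj] := eqVneq P`_j.+1 0; first by rewrite mul0r vge0.
have PjL : P`_j.+1 \in L by apply: (polyOverP PL).
have bj := expf_neq0 j.+1 b0.
have := hP j.+1; have [m wm] := uniformizer_dvd w_val uu PjL Pj.
rewrite !vgeE ?mulf_neq0 // (Defs.valM w_val) // valuationX // wm w_uW w_b.
rewrite !mulrA -mulrDl pmulr_lge0 // le_eqVlt => /orP[/eqP e|]; last first.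
  by rewrite gtz0_ge1 => h; rewrite -[X in X <= _]mul1r ler_pM2r.
have : (p %| j.+1 * `|k|)%N.
  have : (j.+1%:Z * k) = - m * p%:Z by rewrite mulNr; apply/eqP; rewrite -addr_eq0 addrC -e.
  by move/(congr1 absz); rewrite !abszM !absz_nat => ->; rewrite dvdn_mull.
rewrite Euclid_dvdM // (negbTE pk) orbF => /(dvdn_leq (ltn0Sn j)).
by rewrite leqNgt jp.
Qed.

(* Serre, Local Fields, IV, Prop. 3: with f the minimal polynomial of Pi over M1, the
   value (g f)(Pi) generates the ideal generated by the elements g z - z of M1. *)
Lemma subextension_break : gamma = delta.
Proof.
have M1gal : galois M1 M by apply: galoisS M_galois; rewrite subv_adjoin.
have /(galois_factors M1M)/(_ Pi PiM)[r [rG ur ef]] := M1gal.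
set f := minPoly M1 Pi in ef; set rs := map _ r in ur ef.
have rs0 x : x \in rs -> vge w 0 x by move=> /mapP[h _ ->]; rewrite vge_autN.
have f0 : pge w 0 f by rewrite ef; apply: pge_prod_XsubC.
have sr : size r = q'.
  have e1 : <<M1; Pi>>%VS = M.
    apply/eqP; rewrite eqEsubv; apply/andP; split; first exact/FadjoinP.
    rewrite -[X in (X <= _)%VS]M_gen; apply/FadjoinP; split.
      exact: subv_trans (subv_adjoin L b) (subv_adjoin M1 Pi).
    exact: memv_adjoin.
  have d1 := dim_Fadjoin M1 Pi; have d2 := dim_Fadjoin L Pi; have d3 := dim_Fadjoin L b.
  have := size_minPoly M1 Pi; rewrite -/f ef size_prod_XsubC size_map => -[->].
  move: d1; rewrite e1 -M_gen d2 M_deg d3 subext_degree mulnA [(p * q')%N]mulnC => /eqP.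
  rewrite eqn_pmul2r ?adim_gt0 // eqn_pmul2r ?prime_gt0 // => /eqP e.
  by apply/esym.
pose gf := map_poly g f.
have egf : gf = \prod_(h <- r) ('X - (g (h Pi))%:P).
  rewrite /gf ef big_map rmorph_prod; apply: eq_bigr => h _.
  by rewrite rmorphB /= map_polyX map_polyC.
(* The products [h * g] with [h] fixing [M1] are nontrivial, because [h] fixes [b] and [g] moves it;
   so all of them displace [Pi] to the same order. *)
have hgP h : h \in r -> Pi - g (h Pi) != 0 /\ w (Pi - g (h Pi)) = (gamma + 1) * w Pi.
  move=> hr; have hG := subsetP rG _ hr.
  have hgG : (h * g)%g \in 'Gal(M / L)%g.
    by rewrite groupM // (subsetP (galS M (subv_adjoin L b))).
  have hg1 : (h * g)%g != 1%g.
    apply: contra gb => /eqP e; have := galM h g bM; rewrite e gal_id.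
    by rewrite (fixed_gal M1M hG) ?memv_adjoin // => <-.
  have [n0 wn] := break_uniformizer w_val w_aut pq0 uu uPi w_u M_gen M_deg gamma_break hgG hg1.
  by rewrite -opprB oppr_eq0 valuationN // -(galM h g PiM).
have gfPi : gf.[Pi] != 0 /\ w gf.[Pi] = (gamma + 1) * W.
  rewrite egf horner_prod.
  have nz : {in r, forall h : gal_of M, ('X - (g (h Pi))%:P).[Pi] != 0}.
    by move=> h hr; rewrite hornerXsubC; have [] := hgP h hr.
  split; first by rewrite prodf_seq_neq0; apply/allP => h hr; apply: nz.
  rewrite (valuation_prod w_val nz) big_seq.
  rewrite (eq_bigr (fun _ => (gamma + 1) * w Pi)); last first.
    by move=> h hr; rewrite hornerXsubC; have [] := hgP h hr.
  rewrite -big_seq big_const_seq count_predT iter_addr_0 sr W_def mulrCA -mulr_natl.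
  by rewrite natz.
have [gf0 wgf] := gfPi.
apply/eqP; rewrite eq_le; apply/andP; split; last first.
  have : vge w ((delta + 1) * W) gf.[Pi].
    have -> : gf.[Pi] = (gf - f).[Pi] by rewrite hornerD hornerN /f minPolyxx subr0.
    apply: vge_horner => // j; rewrite coefB coef_map /=; apply: subext_break_ge => //.
    by have /polyOverP := minPolyOver M1 Pi.
  by rewrite vgeE // wgf ler_pM2r // lerD2r.
(* Bezout on [k] and [p] gives [z] the valuation [W]: a uniformizer of [M1] that is moved to the
   exact order prescribed by [delta]. *)
have [j [m [ejm pj]]] := prime_bezout p_prime pk.
have [uL u0 _ _] := uu.
pose z := b ^+ j * u ^ m.
have bj := expf_neq0 j b0; have um : u ^ m != 0 by rewrite expfz_neq0.
have z0 : z != 0 by rewrite mulf_neq0.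
have wz : w z = W.
  rewrite (Defs.valM w_val) // valuationX // valuation_exprz // w_b w_uW mulrA.
  by rewrite [m * _]mulrCA mulrA -mulrDl ejm mul1r.
have zM1 : z \in M1.
  apply: memvM; first by rewrite rpredX ?memv_adjoin.
  by apply: memv_exprz; apply: (subvP (subv_adjoin L b)).
have zM := subvP M1M _ zM1.
have z_int : vge w 0 z by rewrite vge_val // wz ltW.
have P0 := totally_ramified_integral w_val pq0 uu uPi w_u M_gen M_deg zM z_int.
have [PL _ eP _] := totally_ramified_expansion w_val uu uPi w_u M_gen M_deg zM.
move: P0 PL eP; set P := Fadjoin_poly L Pi z => P0 PL eP.
have Hroot x : x \in rs -> root (P - z%:P) x.
  move=> /mapP[h hr ->]; have hG := subsetP rG _ hr.
  have hGL := subsetP (galS M (subv_adjoin L b)) _ hG.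
  have -> : z = P.[h Pi].
    rewrite -[LHS](fixed_gal M1M hG zM1) -[in LHS]eP -horner_map /=.
    by rewrite (fixedPoly_gal LM hGL PL).
  by rewrite rootE !hornerE subrr.
have H0 : pge w 0 (P - z%:P) by apply: pgeB => //; apply: pgeC.
have [Q eQ Q0] := pge_div_prod_XsubC ur rs0 H0 Hroot.
(* [P] has coefficients in [L] and value [z] at [Pi]: apply [g] to the coefficients in
   [P - z = Q f], then evaluate at [Pi]. *)
have ezgz : z - g z = (map_poly g Q).[Pi] * gf.[Pi].
  rewrite /gf ef -hornerM -rmorphM -eQ rmorphB /= map_polyC /= (fixedPoly_gal LM gG PL).
  by rewrite !hornerE eP.
have : vge w ((gamma + 1) * W) (z - g z).
  rewrite ezgz; apply: vge0M => //; last by rewrite vge_val ?wgf.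
  by apply: vge_horner => // i; rewrite coef_map /= vge_autN.
have -> : z - g z = - (z * (y ^+ j - 1)).
  rewrite rmorphM rmorphXn /= (_ : g (u ^ m) = u ^ m); last first.
    by rewrite (fixed_gal LM gG) // memv_exprz.
  rewrite mulrBr mulr1 opprB /z /y expr_div_n mulrAC; congr (_ - _).
  by rewrite [b ^+ j * _]mulrC divfK.
rewrite vgeN // mulrDl mul1r addrC -wz vge_pmul // (vge_subX1E w_val p_prime w_p _ y1' pj).
have y1n : y - 1 != 0.
  by rewrite subr_eq0; apply: contra gb => /eqP e; rewrite -(divfK b0 (g b)) -/y e mul1r.
by rewrite (vgeE w _ y1n) wz w_gb ler_pM2r.
Qed.

End SubextensionBreak.

(** * Euler's trace formula and the different *)

Section TraceFormula.
Variables (K : fieldType) (N : splittingFieldType K) (E : {subfield N}) (t : N).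
Hypothesis E_gen : <<1; t>>%VS = E.
Let f := minPoly 1%AS t.
Let q := adjoin_degree 1%AS t.

(** Coordinates in the basis of powers of [t], kept in [N] rather than in [K]. *)
Definition gen_coef (j : nat) (z : N) : N := (Fadjoin_poly 1%AS t z)`_j.

Lemma gen_coefD j : {morph gen_coef j : x y / x + y}.
Proof. by move=> x y; rewrite /gen_coef linearD coefD. Qed.

Lemma gen_coefZ j k z : gen_coef j (k *: z) = k%:A * gen_coef j z.
Proof. by rewrite /gen_coef linearZ /= coefZ. Qed.

Lemma gen_coef_sum j (I : finType) (G : I -> N) :
  gen_coef j (\sum_i G i) = \sum_i gen_coef j (G i).
Proof. by rewrite /gen_coef linear_sum coef_sum. Qed.

Lemma gen_coef_base j z : exists k : K, gen_coef j z = k%:A.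
Proof.
apply/vlineP; have /polyOverP := Fadjoin_polyOver 1%AS t z; exact.
Qed.

Lemma gen_coef_expansion z : z \in E -> z = \sum_(j < q) gen_coef j z * t ^+ j.
Proof.
rewrite -E_gen => /Fadjoin_poly_eq {1}<-.
by rewrite (horner_coef_wide _ (size_Fadjoin_poly _ _ _)).
Qed.

(** The companion matrix of [f]: the shifted polynomial is reduced by its top coefficient times the
    monic [f]. *)
Lemma gen_coefMt j z : z \in E ->
  gen_coef j (t * z) = (if j is i.+1 then gen_coef i z else 0) - f`_j * gen_coef q.-1 z.
Proof.
rewrite -E_gen => zE; set P := Fadjoin_poly 1%AS t z.
have PK : P \is a polyOver 1%AS by apply: Fadjoin_polyOver.
have fK : f \is a polyOver 1%AS by apply: minPolyOver.
have szf : size f = q.+1 by apply: size_minPoly.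
have szP : (size P <= q)%N by apply: size_Fadjoin_poly.
have q0 : (0 < q)%N by [].
have lf : f`_q = 1.
  by have := monic_minPoly 1%AS t; rewrite monicE lead_coefE -/f szf => /eqP.
have eP : Fadjoin_poly 1%AS t (t * z) = P * 'X - P`_q.-1 *: f.
  apply: Fadjoin_poly_unique.
  - by rewrite rpredB ?rpredM ?polyOverX // polyOverZ // (polyOverP PK).
  - apply/leq_sizeP => i qi; rewrite coefB coefMX coefZ.
    have [->|nqi] := eqVneq i q.
      by rewrite lf mulr1 gtn_eqF // subrr.
    have lt : (q < i)%N by rewrite ltn_neqAle eq_sym nqi.
    rewrite (nth_default _ (_ : size f <= i)%N) ?szf // mulr0 subr0.
    rewrite gtn_eqF ?(leq_trans q0) // nth_default //.
    by apply: leq_trans szP _; case: i lt {qi nqi}.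
  by rewrite hornerD hornerN hornerZ hornerMX minPolyxx mulr0 subr0 Fadjoin_poly_eq // mulrC.
by rewrite /gen_coef eP coefB coefMX coefZ mulrC; case: j.
Qed.

(* If f = g (X - t) then the coefficients of g form, for the form gen_coef q.-1 (x y),
   the dual basis of the powers of t. *)
Lemma gen_coef_dual (g : {poly N}) : f = g * ('X - t%:P) -> size g = q ->
  forall (j : nat), (j < q)%N -> g`_j \in E /\
    forall z, z \in E -> gen_coef j z = gen_coef q.-1 (g`_j * z).
Proof.
move=> fg sg; have szf : size f = q.+1 by apply: size_minPoly.
have lf : f`_q = 1.
  by have := monic_minPoly 1%AS t; rewrite monicE lead_coefE -/f szf => /eqP.
have tE : t \in E by rewrite -E_gen memv_adjoin.
have rec i : f`_i.+1 = g`_i - g`_i.+1 * t.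
  by rewrite fg mulrBr coefB coefMX coefMC.
have q0 : (0 < q)%N by [].
have gq : g`_q = 0 by rewrite nth_default ?sg.
have glast : g`_q.-1 = 1.
  by have := rec q.-1; rewrite prednK // lf gq mul0r subr0 => ->.
suff H m j : (m + j = q.-1)%N -> g`_j \in E /\
    forall z, z \in E -> gen_coef j z = gen_coef q.-1 (g`_j * z).
  move=> j jq; apply: (H (q.-1 - j)%N); rewrite subnK // -ltnS prednK //.
elim: m j => [|m IH] j ej.
  by rewrite add0n in ej; rewrite ej glast mem1v; split=> // z _; rewrite mul1r.
have [|gjE hj] := IH j.+1; first by rewrite addnS -addSn.
have gj : g`_j = f`_j.+1 + g`_j.+1 * t by rewrite rec subrK.
have fj1 : f`_j.+1 \in 1%AS by have /polyOverP := minPolyOver 1%AS t; apply.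
have fjE : f`_j.+1 \in E by apply: (subvP (sub1v E)).
split=> [|z zE]; first by rewrite gj memvD // memvM.
have := gen_coefMt j.+1 zE; rewrite hj; last by rewrite memvM.
move/eqP; rewrite eq_sym subr_eq => /eqP->.
rewrite gj mulrDl gen_coefD addrC mulrA; congr (_ + _).
have /vlineP[k ->] := fj1.
by rewrite !mulr_algl gen_coefZ mulr_algl.
Qed.

(** The trace is defined in [vbasis E]; expanding that basis in powers of [t] and exchanging the
    sums moves it to the power basis. *)
Lemma ext_trace_gen x : x \in E ->
  (ext_trace E x)%:A = \sum_(j < q) gen_coef j (x * t ^+ j) :> N.
Proof.
move=> xE; have tE : t \in E by rewrite -E_gen memv_adjoin.
set B := vbasis E.
have /fin_all_exists[k hk] : forall ij : 'I_(\dim E) * 'I_q,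
    exists k : K, gen_coef ij.2 B`_ij.1 = k%:A.
  by move=> ij; apply: gen_coef_base.
have BE i : (i < \dim E)%N -> B`_i \in E.
  by move=> iE; apply/vbasis_mem/mem_nth; rewrite size_tuple.
rewrite /ext_trace scaler_suml.
have step (i : 'I_(\dim E)) : (coord B i (x * B`_i))%:A =
    \sum_(j < q) (k (i, j) * coord B i (x * t ^+ j))%:A :> N.
  rewrite -scaler_suml; congr (_%:A).
  rewrite [in LHS](gen_coef_expansion (BE i (ltn_ord i))) mulr_sumr linear_sum.
  apply: eq_bigr => j _; rewrite (hk (i, j)) /= mulr_algl -scalerAr linearZ.
  by [].
under eq_bigr do rewrite step.
rewrite exchange_big; apply: eq_bigr => j _ /=.
have xtE : x * t ^+ j \in E by rewrite memvM ?rpredX.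
rewrite [in RHS](coord_vbasis xtE) gen_coef_sum; apply: eq_bigr => i _.
by rewrite gen_coefZ (hk (i, j)) mulr_algl scalerA mulrC.
Qed.

(** With [f = g (X - t)] one has [f'(t) = g(t)]. By duality each diagonal coordinate of the trace
    becomes the top coordinate of [x] times one term of [g(t)]. *)
Lemma ext_trace_euler x : x \in E ->
  (ext_trace E x)%:A = gen_coef q.-1 (x * f^`().[t]) :> N.
Proof.
move=> xE; have tE : t \in E by rewrite -E_gen memv_adjoin.
have [g fg sg] := divXsubC f t.
rewrite minPolyxx addr0 in fg; rewrite size_minPoly /= in sg.
have dual := gen_coef_dual fg sg.
rewrite ext_trace_gen //.
have -> : f^`().[t] = \sum_(j < q) g`_j * t ^+ j.
  rewrite [in LHS]fg derivM derivXsubC mulr1 !hornerE subrr mulr0 add0r.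
  by rewrite horner_coef sg.
rewrite mulr_sumr gen_coef_sum; apply: eq_bigr => j _.
have [_ ->] := dual j (ltn_ord j); last by rewrite memvM ?rpredX.
by rewrite mulrCA.
Qed.

End TraceFormula.

Section Different.
Variables (K : fieldType) (N : splittingFieldType K) (v : K -> int) (w : N -> int).
Hypothesis w_val : normalized_valuation w.
Hypothesis w_ext : extends_valuation v w.
Variables (E : {subfield N}) (s t : N).
Let q := adjoin_degree 1%AS t.
Hypothesis E_gen : <<1; t>>%VS = E.
Hypothesis us : uniformizer w 1%AS s.
Hypothesis ut : uniformizer w E t.
Hypothesis w_s : w s = q%:Z * w t.

Let t0 : t != 0. Proof. by case: ut. Qed.
Let wt : 0 < w t. Proof. by case: ut. Qed.
Let tE : t \in E. Proof. by case: ut. Qed.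
Let q0 : (0 < q)%N. Proof. by []. Qed.

Lemma alg_integral c : vge w 0 c%:A = vge v 0 c.
Proof.
have [e e0 we] := w_ext.
have [->|c0] := eqVneq c 0; first by rewrite scale0r !vge0.
rewrite !vgeE ?scaler_eq0 ?negb_or ?c0 ?oner_neq0 // we // pmulr_rge0 //.
Qed.

(** The ring of integers of [E] is its own dual for the form given by the top coordinate of a
    product: a pole of [z] is detected by a suitable power of [t]. *)
Lemma gen_coef_integral z : z \in E ->
  (forall y, y \in E -> vge w 0 y -> vge w 0 (gen_coef t q.-1 (z * y))) <-> vge w 0 z.
Proof.
move=> zE; split=> [h|z0 y yE y0]; last first.
  apply: (totally_ramified_integral w_val q0 us ut w_s E_gen (erefl q)).
    by rewrite memvM.
  by rewrite vge0M.
have [->|zn0] := eqVneq z 0; first exact: vge0.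
rewrite vgeE // leNgt; apply/negP => zneg.
have [k wz] := uniformizer_dvd w_val ut zE zn0.
have kneg : k < 0 by move: zneg; rewrite wz pmulr_llt0.
(* This [j] makes the valuation of [z * t ^+ j], in units of [w t], negative and congruent to -1
   modulo [q]. Only the term in [t ^+ q.-1] can have that valuation, yet it is integral by
   hypothesis. *)
have [m [j [jq ekm]]] := int_euclid (- k - 1) q0.
have yE : t ^+ j \in E by rewrite rpredX.
have y0 : vge w 0 (t ^+ j) by rewrite vge0X // vge_val // ltW.
have := h _ yE y0; set P1 := gen_coef _ _ _ => P1_int.
have zyE : z * t ^+ j \in E by rewrite memvM.
have zy0 : z * t ^+ j != 0 by rewrite mulf_neq0 ?expf_neq0.
have wzy : w (z * t ^+ j) = (- m * q%:Z - 1) * w t.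
  rewrite (Defs.valM w_val zn0 (expf_neq0 j t0)) (valuationX w_val j t0) wz -mulrDl; congr (_ * _).
  by move: ekm; set mq := m * _; rewrite mulNr -/mq; clear; lia.
have m0 : 0 <= m by move: ekm kneg jq; clear; nia.
have wzyneg : w (z * t ^+ j) + 1 <= 0.
  rewrite lezD1 wzy pmulr_llt0 //; move: m0 q0; clear; nia.
have [PL sP eP hP] := totally_ramified_expansion w_val us ut w_s E_gen (erefl q) zyE.
move: PL sP eP hP P1_int; rewrite /P1 /gen_coef; set P := Fadjoin_poly _ _ _ => PL sP eP hP P1_int.
have : vge w (w (z * t ^+ j) + 1) (z * t ^+ j).
  rewrite -[in X in vge _ _ X]eP (horner_coef_wide _ sP); apply: vge_sum => // -[i iq] _ /=.
  have [->|iq1] := eqVneq i q.-1.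
    apply: vge_le wzyneg _; apply: vge0M => //; apply: vge0X => //.
    by rewrite vge_val // ltW.
  have := hP _ (vge_val (lexx _)) i.
  have [->|Pi0] := eqVneq P`_i 0; first by rewrite mul0r !vge0.
  have PiK : P`_i \in 1%AS by apply: (polyOverP PL).
  have ti := expf_neq0 i t0.
  have [a wa] := uniformizer_dvd w_val us PiK Pi0.
  rewrite wzy !vgeE ?mulf_neq0 // (Defs.valM w_val) // valuationX // wa w_s => le.
  rewrite lezD1 lt_neqAle le andbT mulrA -mulrDl; apply/eqP => /mulIf -/(_ (lt0r_neq0 wt)) e.
  have : (a + m) * q%:Z = - (i.+1)%:Z.
    by rewrite mulrDl intS; move: e; rewrite mulNr; set A := a * _; set B := m * _; clear; lia.
  move/(congr1 (fun x => - x)); rewrite opprK -mulNr => /dvdn_intmul/(dvdn_leq (ltn0Sn i)) qi.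
  by move/negP: iq1; apply; rewrite -eqSS prednK // eqn_leq qi iq.
by rewrite vgeE // gerDl ler10.
Qed.

(** By Euler's formula and self-duality the codifferent is [D^-1 O_E]. Testing this at [D^-1] and at
    [t ^ (- d)] gives the two inequalities. *)
Lemma different_exponent_gen d : (minPoly 1%AS t)^`().[t] != 0 ->
  different_exponent v w E d -> w (minPoly 1%AS t)^`().[t] = d%:Z * w t.
Proof.
set D := _.[t] => D0 diff.
have DE : D \in E.
  rewrite -E_gen; apply: mempx_Fadjoin; apply: polyOver_deriv.
  exact: minPolyOver.
have key x : x \in E -> vge w 0 (x * D) <-> vge w (- d%:Z * w t) x.
  move=> xE; have xDE : x * D \in E by rewrite memvM.
  rewrite -(gen_coef_integral xDE).
  have [d1 d2] := diff x xE; split=> h.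
    suff /(pidealE _ _ ut)[] : pideal w E (- d%:Z) x by [].
    apply: d1 => y /(pidealE _ _ ut)[yE].
    rewrite mul0r => y0; rewrite -alg_integral (ext_trace_euler E_gen) ?memvM //.
    by rewrite mulrAC; apply: h.
  move=> y yE y0; rewrite mulrAC -(ext_trace_euler E_gen) ?memvM // alg_integral.
  apply: d2; first by apply/(pidealE _ _ ut).
  by apply/(pidealE _ _ ut); rewrite mul0r.
apply/eqP; rewrite eq_le; apply/andP; split.
  have DVE : D^-1 \in E by rewrite memvV.
  have [h _] := key _ DVE; have := h; rewrite mulVf // vge1 // => /(_ isT).
  by rewrite vgeE ?invr_eq0 // valuationV // mulNr lerN2.
have tdE : t ^ (- d%:Z) \in E by rewrite memv_exprz.
have td0 : t ^ (- d%:Z) != 0 by rewrite expfz_neq0.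
have [_ h] := key _ tdE; have := h; rewrite vgeE // valuation_exprz // lexx => /(_ isT).
rewrite vgeE ?mulf_neq0 // (Defs.valM w_val) // valuation_exprz //.
by rewrite mulNr addrC subr_ge0.
Qed.

End Different.

Lemma horner_deriv_prod_XsubC (R : comNzRingType) (rs : seq R) t : t \in rs ->
  (\prod_(r <- rs) ('X - r%:P))^`().[t] = \prod_(r <- rem t rs) (t - r).
Proof.
move=> trs; rewrite (perm_big _ (perm_to_rem trs)) big_cons /= derivM derivXsubC mul1r.
rewrite !hornerE subrr mul0r addr0 horner_prod; apply: eq_bigr => r _.
by rewrite hornerXsubC.
Qed.

Section AdjoinRoots.
Variables (K : fieldType) (N : splittingFieldType K).

(** The image of [M] under an automorphism over [F] splits the same polynomials, so it contains [M]
    by minimality; the dimensions are equal. *)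
Lemma adjoin_roots_galois (F M : {subfield N}) (P : {poly N} -> Prop) :
  galois 1%AS {:N}%AS -> adjoin_roots F P M -> (forall q, P q -> q \is a polyOver F) ->
  galois F M.
Proof.
move=> N_galois [FM spl min] PF.
have /and3P[_ sepN _] := galois_over N_galois F.
apply/and3P; split=> //; first exact: separableSr (subvf M) sepN.
apply/forall_inP => f; rewrite inE kAutfE => /kAHomP fF.
have dimf : \dim (f @: M) = \dim M by apply: limg_dim_eq; rewrite (eqP (AEnd_lker0 f)) capv0.
have sub : (M <= (f @: M)%AS)%VS.
  apply: min => [|q Pq]; first by apply/subvP => x xF; rewrite -(fF x xF) memv_img // (subvP FM).
  have [rs eq_rs rsM] := spl q Pq; exists (map f rs).
    have <- : map_poly f q = q.
      apply/polyP => i; rewrite coef_map /=; apply: fF.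
      by have /polyOverP := PF q Pq; apply.
    have -> : \prod_(z <- map f rs) ('X - z%:P) = map_poly f (\prod_(z <- rs) ('X - z%:P)).
      rewrite big_map rmorph_prod; apply: eq_bigr => z _.
      by rewrite rmorphB /= map_polyX map_polyC.
    by rewrite eqp_map.
  by move=> _ /mapP[x xrs ->]; rewrite memv_img // rsM.
by rewrite eq_sym eqEdim sub /= dimf.
Qed.

End AdjoinRoots.

(** * The compositum [M] of [E] and [L], and the conjugates of [t] *)

Section Compositum.
Variables (p : nat) (K : fieldType) (v : K -> int) (N : splittingFieldType K) (w : N -> int).
Hypothesis p_prime : prime p.
Hypothesis K_pfield : p_field p v.
Hypothesis N_galois : galois 1%AS {:N}%AS.
Hypothesis w_val : normalized_valuation w.
Hypothesis w_ext : extends_valuation v w.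

Variables (e : nat) (s t u zeta : N) (E L : {subfield N}).
Hypothesis pe : ~~ (p %| e)%N.
Hypothesis us : uniformizer w 1%AS s.
Hypothesis ut : uniformizer w E t.
Hypothesis zeta_root : zeta ^+ e = 1.
Hypothesis L_def : adjoin_all_radicals e <<1; zeta>>%AS L.
Hypothesis uL : u \in L.
Hypothesis us_e : u ^+ e = s.
Hypothesis E_gen : <<1; t>>%VS = E.
Hypothesis E_deg : \dim E = e.+1.
Hypothesis w_s : w s = e.+1%:Z * w t.
Let M := (E * L)%AS.
Let Pi := u / t.

Let t0 : t != 0. Proof. by case: ut. Qed.
Let wt : 0 < w t. Proof. by case: ut. Qed.
Let e0 : (0 < e)%N. Proof. by case: e pe; rewrite ?dvdn0. Qed.
Let u0 : u != 0. Proof. exact: (tame_uniformizer_neq0 pe us us_e). Qed.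
Let EM : (E <= M)%VS. Proof. exact: field_subvMr. Qed.
Let LM : (L <= M)%VS. Proof. exact: field_subvMl. Qed.
Let tM : t \in M. Proof. by apply: (subvP EM); case: ut. Qed.

Lemma compositum_val_u : w u = e.+1%:Z * w Pi.
Proof.
have := tame_uniformizer_val w_val pe us us_e.
rewrite (Defs.valM w_val) ?invr_eq0 // valuationV // mulrBr -w_s => ->.
by rewrite intS mulrDl mul1r addrK.
Qed.

Lemma compositum_val_t : w t = e%:Z * w Pi.
Proof.
have := compositum_val_u; rewrite (Defs.valM w_val) ?invr_eq0 // valuationV //.
by rewrite intS mulrDl mul1r; move: (e%:Z * _) => A; clear; lia.
Qed.

Let Pi0 : Pi != 0. Proof. by rewrite mulf_neq0 ?invr_eq0. Qed.
Let wPi : 0 < w Pi.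
Proof. by move: wt; rewrite compositum_val_t pmulr_rgt0 // ltz_nat. Qed.
Let PiM : Pi \in M.
Proof. by apply: memvM; [apply: (subvP LM) | rewrite memvV]. Qed.

(** Values of [M] are combinations of [w t], which is [e] times [w Pi], and of [w u], which is
    [e + 1] times [w Pi]. The hypothesis on values of [E] holds because [e] and [e + 1] are
    coprime. *)
Lemma compositum_uniformizer : uniformizer w M Pi.
Proof.
split=> // x xM x0 wx.
have [||a [j [aE a0 wxa]]] := tame_closure_val p_prime K_pfield N_galois w_val w_ext pe us
    zeta_root L_def us_e (F := E) (x := x) _ _ x0; last first.
- have [k wk] := uniformizer_dvd w_val ut aE a0.
  move: wx; rewrite wxa wk compositum_val_t compositum_val_u !mulrA -mulrDl.
  rewrite pmulr_lgt0 // => h; rewrite -[X in X <= _]mul1r ler_pM2r //.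
- exact: xM.
move=> a j aE a0; have [k ->] := uniformizer_dvd w_val ut aE a0.
rewrite compositum_val_t compositum_val_u !mulrA => /mulIf -/(_ (lt0r_neq0 wPi)).
rewrite -PoszM => /(congr1 absz); rewrite abszM !absz_nat => h.
have : (e %| j * e.+1)%N by rewrite -h dvdn_mull.
by rewrite Gauss_dvdl // coprimenS.
Qed.

Lemma compositum_L_uniformizer : uniformizer w L u.
Proof.
exact: (tame_closure_uniformizer p_prime K_pfield N_galois w_val w_ext pe us zeta_root L_def uL us_e).
Qed.

(** Valuations force the degree of [Pi] over [L] to be at least [e + 1], while [t] generates [M]
    over [L] with degree at most [e + 1]. So the minimal polynomial of [t] over [K] stays
    irreducible over [L], and its roots can be reached by [Gal(M | L)]. *)
Lemma compositum_structure :
  [/\ <<L; Pi>>%VS = M, adjoin_degree L Pi = e.+1 & minPoly L t = minPoly 1%AS t].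
Proof.
have M_t : <<L; t>>%VS = M.
  apply/eqP; rewrite eqEsubv; apply/andP; split; first exact/FadjoinP.
  rewrite -[X in (_ <= X)%VS]prodv_id prodvS ?subv_adjoin //.
  by rewrite -E_gen; apply/FadjoinP; rewrite sub1v memv_adjoin.
have deg1 : adjoin_degree 1%AS t = e.+1.
  by have := dim_Fadjoin 1%AS t; rewrite E_gen E_deg dimv1 muln1.
have degL : (adjoin_degree L t <= e.+1)%N.
  rewrite -ltnS -size_minPoly -deg1 -size_minPoly; apply: dvdp_leq.
    by rewrite monic_neq0 ?monic_minPoly.
  exact: minPolyS (sub1v L).
have sep : separated w L Pi e.+1.
  by apply: (totally_ramified_separated w_val compositum_L_uniformizer compositum_uniformizer); exact: compositum_val_u.
have degPi := separated_degree w_val Pi0 sep.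
have sub : (<<L; Pi>> <= M)%VS by apply/FadjoinP.
have d1 := dim_Fadjoin L Pi; have d2 := dim_Fadjoin L t; rewrite M_t in d2.
have L0 : (0 < \dim L)%N by apply: adim_gt0.
have d3 := dimvS sub; rewrite d1 d2 leq_pmul2r // in d3.
have eL : adjoin_degree L t = e.+1.
  by apply/eqP; rewrite eqn_leq degL (leq_trans degPi).
have ePi : adjoin_degree L Pi = e.+1.
  by apply/eqP; rewrite eqn_leq degPi (leq_trans d3).
split=> //; first by apply/eqP; rewrite eqEdim sub d1 d2 ePi eL leqnn.
apply/eqP; rewrite -eqp_monic ?monic_minPoly // -dvdp_size_eqp.
  by rewrite !size_minPoly eL deg1.
exact: minPolyS (sub1v L).
Qed.

Hypothesis M_galois : galois L M.
Variable gamma : int.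
Hypothesis gamma_break : ramification_break w M L gamma.
Hypothesis gamma_gt0 : 0 < gamma.

Let w_aut := val_aut (pfield_complete K_pfield) w_val w_ext.
Let w_p := vge_p K_pfield w_ext.

(** Write [t = c * Pi ^+ e] with a unit [c]. The ratio [g c / c] is 1 to order [gamma + 1], while
    [(g Pi / Pi) ^+ e] is 1 to order exactly [gamma], as [p] does not divide [e] and [gamma > 0]
    makes [g Pi / Pi] a 1-unit. *)
Lemma break_val_t (g : gal_of M) : g \in 'Gal(M / L)%g -> g != 1%g ->
  t - g t != 0 /\ w (t - g t) = w t + gamma * w Pi.
Proof.
move=> gG g1; have [M_gen M_deg _] := compositum_structure.
have uL' := compositum_L_uniformizer; have uM := compositum_uniformizer.
have brk := break_integral uM gamma_break gG.
have [n0 wn] := break_uniformizer w_val w_aut (ltn0Sn e) uL' uM compositum_val_u M_gen M_deg gamma_break gG g1.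
have Pie := expf_neq0 e Pi0.
pose c := t / Pi ^+ e.
have c0 : c != 0 by rewrite mulf_neq0 ?invr_eq0.
have wc : w c = 0.
  by rewrite (Defs.valM w_val) ?invr_eq0 // valuationV // valuationX // compositum_val_t subrr.
have cM : c \in M by apply: memvM => //; rewrite memvV rpredX.
have gc0 : g c != 0 by rewrite fmorph_eq0.
pose y := g Pi / Pi; pose z := g c / c.
have y1 : y - 1 = (g Pi - Pi) / Pi by rewrite mulrBl divff.
have y1n : y - 1 != 0 by rewrite y1 mulf_neq0 ?invr_eq0.
have wy : w (y - 1) = gamma * w Pi.
  by rewrite y1 (Defs.valM w_val) ?invr_eq0 // valuationV // wn mulrDl mul1r addrK.
have y1g : vge w 1 (y - 1) by rewrite vge_val // wy -gtz0_ge1 mulr_gt0.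
have z1 : vge w ((gamma + 1) * w Pi) (z - 1).
  have := brk c cM (vge_val (_ : 0 <= w c)); rewrite wc lexx => /(_ isT).
  by rewrite -(@vge_pmul _ _ w_val _ c (z - 1) c0) wc add0r /z mulrBr mulr1 [c * _]mulrC divfK.
have ye : forall i, vge w i (y ^+ e - 1) = vge w i (y - 1).
  by move=> i; apply: (vge_subX1E w_val p_prime w_p).
have ye0 : y ^+ e - 1 != 0.
  apply: contraNneq y1n => ye1; apply/eqP/(vge_eq0 (v := w)) => k.
  by rewrite -ye ye1 vge0.
have wye : w (y ^+ e - 1) = gamma * w Pi.
  apply/eqP; rewrite eq_le -!(vgeE w _ ye0) -wy.
  have h := ye (w (y ^+ e - 1)); rewrite !vgeE // lexx in h.
  by rewrite -h ye vgeE // lexx.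
have small : vge w (w (y ^+ e - 1) + 1) (z * (y ^+ e - 1) - (y ^+ e - 1) + (z - 1)).
  have z1' : vge w (gamma * w Pi + 1) (z - 1).
    by apply: vge_le z1; rewrite mulrDl mul1r lerD2l -gtz0_ge1.
  rewrite wye; apply: vgeD => //; rewrite -[X in _ - X]mul1r -mulrBl.
  by apply: vgeM0 => //; rewrite vge_val // wye mulr_ge0 // ltW.
have [r0 wr] := valuationD_small w_val ye0 small.
have er : y ^+ e - 1 + (z * (y ^+ e - 1) - (y ^+ e - 1) + (z - 1)) = g t / t - 1.
  have -> : g t / t = z * y ^+ e.
    have -> : t = c * Pi ^+ e by rewrite divfK.
    by rewrite rmorphM rmorphXn /= /z /y [(g Pi / Pi) ^+ e]expr_div_n invfM mulrACA.
  have ring_id (a b : N) : b - 1 + (a * (b - 1) - (b - 1) + (a - 1)) = a * b - 1 by ring.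
  exact: ring_id.
rewrite er in r0 wr.
have -> : t - g t = - t * (g t / t - 1) by rewrite mulNr mulrC mulrBl mul1r divfK // opprB.
split; first by rewrite mulf_neq0 // oppr_eq0.
by rewrite (Defs.valM w_val) ?oppr_eq0 // valuationN // wr wye.
Qed.

Lemma different_val_t : (minPoly 1%AS t)^`().[t] != 0 /\
  w (minPoly 1%AS t)^`().[t] = (e%:Z + gamma) * w t.
Proof.
have [M_gen M_deg <-] := compositum_structure.
have /(galois_factors LM)/(_ t tM)[r [rG ur ef]] := M_galois.
set rs := map _ r in ur ef.
have trs : t \in rs by rewrite -root_prod_XsubC -ef root_minPoly.
rewrite ef horner_deriv_prod_XsubC //.
have srs : size (rem t rs) = e.
  have [_ _ eLK] := compositum_structure; have := size_minPoly 1%AS t.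
  rewrite -eLK ef size_prod_XsubC => /succn_inj srs.
  by have := dim_Fadjoin 1%AS t; rewrite E_gen E_deg dimv1 muln1 -srs size_rem // => <-.
have val x : x \in rem t rs -> t - x != 0 /\ w (t - x) = w t + gamma * w Pi.
  rewrite (mem_rem_uniq _ ur) inE => /andP[xt /mapP[g gr ex]].
  rewrite ex; apply: break_val_t; first exact: (subsetP rG).
  by apply: contraNneq xt => g1; rewrite ex g1 gal_id.
have nz : {in rem t rs, forall x, t - x != 0} by move=> x /val[].
split; first by rewrite prodf_seq_neq0; apply/allP => x /nz.
rewrite (valuation_prod w_val nz) big_seq (eq_bigr (fun _ => w t + gamma * w Pi)); last first.
  by move=> x /val[].
rewrite -big_seq big_const_seq count_predT iter_addr_0 srs -mulr_natl natz.
(* There are [e] factors, and [e] times [w Pi] is [w t]. *)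
by rewrite mulrDr mulrDl mulrCA -compositum_val_t.
Qed.

End Compositum.

(** * Roots of unity, Kummer and Artin-Schreier generators: the break from the level *)

Section RootsOfUnity.
Variables (F : fieldType) (v : F -> int) (p : nat).
Hypothesis v_val : normalized_valuation v.
Hypothesis p_prime : prime p.
Implicit Types (a z : F).

Lemma prime_root_primitive z : z ^+ p = 1 -> z != 1 -> p.-primitive_root z.
Proof.
move=> zp z1; have [m pm /(prime_nt_dvdP p_prime)] := prim_order_exists (prime_gt0 p_prime) zp.
move=> <- //; apply: contraNneq z1 => m1.
by have := prim_expr_order pm; rewrite m1 expr1 => ->.
Qed.

Lemma prod_subX_root z a : z ^+ p = 1 -> z != 1 ->
  \prod_(0 <= j < p) (a - z ^+ j) = a ^+ p - 1.
Proof.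
move=> zp z1; have := factor_Xn_sub_1 (prime_root_primitive zp z1).
move/(congr1 (fun P => P.[a])); rewrite horner_prod !hornerE => <-.
by apply: eq_bigr => j _; rewrite hornerXsubC.
Qed.

Lemma root_unity_val z : z ^+ p = 1 -> z != 0 /\ v z = 0.
Proof.
move=> zp; have p0 := prime_gt0 p_prime.
have z0 : z != 0.
  by apply/eqP => e; move/eqP: zp; rewrite e expr0n gtn_eqF // eq_sym oner_eq0.
split=> //; have := valuationX v_val p z0; rewrite zp valuation1 //.
by move=> /esym/eqP; rewrite mulf_eq0 (eqz_nat p 0) gtn_eqF // => /eqP.
Qed.

Lemma root_unity_sub1_val z z' : z ^+ p = 1 -> z != 1 -> z' ^+ p = 1 -> z' != 1 ->
  v (z - 1) = v (z' - 1).
Proof.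
suff H y y' : y ^+ p = 1 -> y != 1 -> y' ^+ p = 1 -> y' != 1 -> v (y - 1) <= v (y' - 1).
  by move=> *; apply/eqP; rewrite eq_le !H.
move=> yp y1 yp' y1'; have [j ej] := prim_rootP (prime_root_primitive yp y1) yp'.
have [y0 vy] := root_unity_val yp.
rewrite -vgeE; first by rewrite ej; apply: vge_subX1; rewrite ?vge_val ?vy.
by rewrite subr_eq0.
Qed.

(** Differentiating the factorization of [X^p - 1] at 1 writes [p] as the product of the [p - 1]
    elements [1 - z ^+ j], all of equal valuation. *)
Lemma root_unity_different z : z ^+ p = 1 -> z != 1 -> p%:R != 0 :> F ->
  p.-1%:Z * v (z - 1) = v p%:R.
Proof.
move=> zp z1 pn0; have p0 := prime_gt0 p_prime.
have fac := factor_Xn_sub_1 (prime_root_primitive zp z1).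
have e : \prod_(1 <= j < p) (1 - z ^+ j) = p%:R.
  move/(congr1 (fun P => P^`().[1])): fac.
  rewrite big_ltn // derivM derivXsubC mul1r expr0 !hornerE subrr mul0r addr0.
  rewrite derivB derivC subr0 derivXn hornerMn hornerXn expr1n horner_prod => <-.
  by apply: eq_bigr => j _; rewrite hornerXsubC.
have hj j : j \in index_iota 1 p -> 1 - z ^+ j != 0 /\ v (1 - z ^+ j) = v (z - 1).
  rewrite mem_index_iota => /andP[j1 jp].
  have zj1 : z ^+ j != 1.
    rewrite -(prim_order_dvd (prime_root_primitive zp z1)).
    by apply/negP => /(dvdn_leq j1); rewrite leqNgt jp.
  split; first by rewrite subr_eq0 eq_sym.
  rewrite -opprB valuationN //; apply: root_unity_sub1_val => //.
  by rewrite -exprM mulnC exprM zp expr1n.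
have nz : {in index_iota 1 p, forall j, 1 - z ^+ j != 0} by move=> j /hj[].
rewrite -e (valuation_prod v_val nz) big_seq (eq_bigr (fun _ => v (z - 1))); last first.
  by move=> j /hj[].
rewrite -big_seq big_const_seq count_predT iter_addr_0 size_iota subn1.
by rewrite -mulr_natl natz.
Qed.

End RootsOfUnity.

Lemma vge_prod_le (F : fieldType) (v : F -> int) (I : Type) (r : seq I) (G : I -> F) B :
  normalized_valuation v -> (forall j, vge v B (G j)) ->
  vge v ((size r)%:Z * B) (\prod_(j <- r) G j).
Proof.
move=> v_val h; elim: r => [|j r IH]; first by rewrite big_nil mul0r vge1.
by rewrite big_cons /= intS mulrDl mul1r; apply: vgeM.
Qed.

Section KummerArtinSchreier.
Variables (K : fieldType) (N : splittingFieldType K) (w : N -> int).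
Hypothesis w_val : normalized_valuation w.
Hypothesis w_aut : forall (f : 'AEnd(N)) x, w (f x) = w x.
Variables (L M : {subfield N}) (u Pi : N) (p q' : nat).
Hypothesis p_prime : prime p.
Hypothesis w_p : vge w 1 p%:R.
Hypothesis q'0 : (0 < q')%N.
Hypothesis coprime_q' : coprime p.-1 (p * q')%N.
Hypothesis uu : uniformizer w L u.
Hypothesis uPi : uniformizer w M Pi.
Hypothesis w_u : w u = (p * q')%N%:Z * w Pi.
Hypothesis M_gen : <<L; Pi>>%VS = M.
Hypothesis M_deg : adjoin_degree L Pi = (p * q')%N.
Hypothesis M_galois : galois L M.
Variable gamma : int.
Hypothesis gamma_break : ramification_break w M L gamma.

Let p0 : (0 < p)%N. Proof. exact: prime_gt0. Qed.
Let p1 : (1 < p)%N. Proof. exact: prime_gt1. Qed.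
Let u0 : u != 0. Proof. by case: uu. Qed.
Let wu : 0 < w u. Proof. by case: uu. Qed.
Let wPi : 0 < w Pi. Proof. by case: uPi. Qed.
Let LM : (L <= M)%VS. Proof. by rewrite -M_gen subv_adjoin. Qed.
Let pq0 : (0 < p * q')%N. Proof. by rewrite muln_gt0 p0. Qed.
Let pz0 : p%:Z != 0. Proof. by rewrite (eqz_nat p 0) -lt0n. Qed.

Lemma vge_uniformizer_succ x (i : int) : x \in L -> vge w (i * w u + 1) x ->
  vge w ((i + 1) * w u) x.
Proof.
move=> xL; have [->|x0] := eqVneq x 0; first by rewrite !vge0.
have [k wx] := uniformizer_dvd w_val uu xL x0.
by rewrite !vgeE // wx lezD1 ltr_pM2r // ler_pM2r // lezD1.
Qed.

Lemma moved_by_galois x : x \in M -> x \notin L ->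
  exists2 g, g \in 'Gal(M / L)%g & g x != x.
Proof.
move=> xM xL; have /galois_fixedField eF := M_galois.
case: (classic (exists2 g, g \in 'Gal(M / L)%g & g x != x)) => // no.
case/negP: xL; rewrite -eF; apply/fixedFieldP => // g gG.
by apply/eqP/negPn/negP => gx; apply: no; exists g.
Qed.

(** The hypothesis carries a factor [p] because the valuation of a generator is known through its
    [p]-th power or through a product of [p] factors. *)
Lemma approximate_in_L x (m : int) : x \in M -> x != 0 -> p%:Z * w x = p%:Z * m * w u ->
  exists2 l, l \in L & vge w (w x + 1) (x - l).
Proof.
move=> xM x0 e; have wx : w x = m * w u by apply: (mulfI pz0); rewrite mulrA.
exact: (totally_ramified_residue w_val pq0 uu uPi w_u M_gen M_deg xM x0 wx).
Qed.

Lemma approximant_neq0 x l : x != 0 -> vge w (w x + 1) (x - l) -> l != 0 /\ w l = w x.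
Proof.
move=> x0; rewrite vgeBC // => h; have := valuationD_small w_val x0 h.
by have -> : x + (l - x) = l by rewrite addrC subrK.
Qed.

(** A uniformizer of [L(b)] has valuation [w u / p]; multiplying the equations by [p] states
    [subextension_break] in terms of [w u] alone. *)
Lemma break_of_generator (b : N) (k delta : int) (g : gal_of M) : b \in M -> b != 0 ->
  p%:Z * w b = k * w u -> ~~ (p%:Z %| k)%Z -> (adjoin_degree L b <= p)%N ->
  g \in 'Gal(M / L)%g -> g b != b -> p%:Z * w (g b / b - 1) = delta * w u ->
  0 < delta -> gamma = delta.
Proof.
move=> bM b0 wb pk bdeg gG gb wgb d0.
have uW : w u = p%:Z * (q'%:Z * w Pi) by rewrite w_u PoszM mulrA.
apply: (subextension_break w_val w_aut p_prime w_p q'0 uu uPi w_u M_gen M_deg M_galois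
  gamma_break bM b0 (erefl (q'%:Z * w Pi)) _ _ bdeg gG gb _ d0 (k := k)).
- by apply: (mulfI pz0); rewrite wb uW mulrCA.
- by apply: contra pk => h; rewrite dvdzE.
by apply: (mulfI pz0); rewrite wgb uW mulrCA.
Qed.

Section Kummer.
Hypothesis pn0 : p%:R != 0 :> N.
Variables (x beta : N) (e i : nat).
Hypothesis e_abs : absolute_ramification_index w p L e.
Hypothesis xL : units_of L x.
Hypothesis x_npow : ~ unit_powers p L x.
Hypothesis betaM : beta \in M.
Hypothesis beta_root : beta ^+ p = x.
Hypothesis x_level : in_Ubar w p L i x.
Hypothesis x_nlevel : ~ in_Ubar w p L i.+1 x.

Let c := (e %/ p.-1)%N.

Lemma kummer_roots (a a' : N) : a != 0 -> a' ^+ p = a ^+ p -> (a' / a) ^+ p = 1.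
Proof. by move=> a0 ea; rewrite expr_div_n ea divff // expf_neq0. Qed.

Lemma kummer_root_notin (a : N) : a != 0 -> a \in M ->
  (exists2 y, units_of L y & x = a ^+ p * y ^+ p) -> a \notin L.
Proof.
move=> a0 aM [y [yL y0] ex]; apply/negP => aL; apply: x_npow.
by exists (a * y); rewrite ?exprMn //; split; rewrite ?mulf_neq0 ?memvM.
Qed.

(** [w (z - 1)] is a multiple of [w Pi], and [p - 1] times it is [w p], that is [e] times [w u]. As
    [p - 1] is prime to [p * q'], it divides [e], so the division defining [c] is exact; [c > 0]
    because [w p > 0]. *)
Lemma root_unity_level (z : N) : z \in M -> z ^+ p = 1 -> z != 1 ->
  w (z - 1) = c%:Z * w u /\ (0 < c)%N.
Proof.
move=> zM zp z1; have := root_unity_different w_val p_prime zp z1 pn0.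
have [t ut wp] := e_abs; rewrite wp (uniformizer_val ut uu) => lam.
have zn0 : z - 1 != 0 by rewrite subr_eq0.
have [k wk] := uniformizer_dvd w_val uPi (memvB zM (mem1v M)) zn0.
have d : (p.-1 %| e)%N.
  move: lam; rewrite wk w_u !mulrA => /mulIf -/(_ (lt0r_neq0 wPi)) h.
  have : (p.-1 %| e * (p * q'))%N.
    by apply: (@dvdn_intmul k); rewrite mulrC h PoszM.
  by rewrite Gauss_dvdl.
have ec : e = (p.-1 * c)%N by rewrite mulnC divnK.
have p10 : p.-1%:Z != 0 by rewrite (eqz_nat _ 0) -lt0n -subn1 subn_gt0.
split; first by apply: (mulfI p10); rewrite lam ec PoszM mulrA.
rewrite lt0n; apply/eqP => c0; move: wp; rewrite ec c0 muln0 mul0r => wp0.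
by move: w_p; rewrite vgeE // wp0.
Qed.

Lemma kummer_conj (a : N) (g : gal_of M) : a != 0 -> a \in M -> a ^+ p \in L ->
  g \in 'Gal(M / L)%g -> g a != a ->
  [/\ (g a / a) ^+ p = 1, g a / a != 1 & w (g a / a - 1) = c%:Z * w u].
Proof.
move=> a0 aM aL gG ga.
have zp : (g a / a) ^+ p = 1.
  by apply: kummer_roots; rewrite // -rmorphXn /= (fixed_gal LM gG).
have z1 : g a / a != 1 by apply: contra ga => /eqP h; rewrite -(divfK a0 (g a)) h mul1r.
by split=> //; apply root_unity_level => //; apply: memvM; rewrite ?memv_gal ?memvV.
Qed.

Lemma kummer_break : gamma = (p * c)%N%:Z - i%:Z /\ 0 < gamma.
Proof.
have [xL' x0] := xL.
have beta0 : beta != 0 by apply: contraNneq x0 => b0; rewrite -beta_root b0 expr0n gtn_eqF.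
have degX (a y : N) : y \in L -> a ^+ p = y -> (adjoin_degree L a <= p)%N.
  move=> yL ay; rewrite -ltnS -(size_XnsubC y p0); apply: adjoin_degree_le.
  - by rewrite rpredB ?polyOverXn ?polyOverC.
  - by rewrite -size_poly_eq0 size_XnsubC.
  - by rewrite root_XnsubC ay.
suff H : exists2 delta : int, delta = (p * c)%N%:Z - i%:Z & 0 < delta /\ gamma = delta.
  by have [d -> [d0 ->]] := H.
exists ((p * c)%N%:Z - i%:Z) => //.
(* An excess of 1 over [j * w u] suffices to reach the next step, since valuations on [L] are
   multiples of [w u]. *)
have u_succ j a : a \in L -> vge w (j%:Z * w u + 1) (a - 1) -> (exists2 y, units_of L y & x = a * y ^+ p) ->
    in_Ubar w p L j.+1 x.
  move=> aL ha [y yL ex]; split=> //; right; exists a, y; split=> //.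
  apply/(pidealE _ _ uu); split; first by rewrite memvB ?mem1v.
  by rewrite -addn1 PoszD; apply: vge_uniformizer_succ => //; rewrite memvB ?mem1v.
have [i0|i0] := posnP i.
  have [m wm] := uniformizer_dvd w_val uu xL' x0.
  have wbeta : p%:Z * w beta = m * w u by rewrite -valuationX // beta_root.
  (* Otherwise some [l] in [L] approximates [beta], and [x / l ^+ p] is a 1-unit, which puts [x]
     into step 1 of the filtration. *)
  have pm : ~~ (p%:Z %| m)%Z.
    apply/negP => /dvdzP[m' em].
    have [l lL hl] : exists2 l, l \in L & vge w (w beta + 1) (beta - l).
      by apply: (@approximate_in_L _ m') => //; rewrite wbeta em [m' * _]mulrC.
    have [l0 wl] := approximant_neq0 beta0 hl.
    apply: x_nlevel; rewrite i0; apply: (u_succ 0%N (x / l ^+ p)).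
    - by rewrite memvM // memvV rpredX.
    - have h1 : vge w 1 (beta / l - 1).
        by rewrite -(@vge_pmul _ _ w_val _ l) // wl mulrBr mulr1 mulrC divfK.
      rewrite mul0r add0r -beta_root -expr_div_n; apply: vge_subX1 => //.
      exact: vge1_unit h1.
    - by exists l; rewrite ?divfK ?expf_neq0.
  have bL : beta \notin L.
    apply: kummer_root_notin => //; exists 1; last by rewrite beta_root expr1n mulr1.
    by split; rewrite ?mem1v ?oner_neq0.
  have [g gG gb] := moved_by_galois betaM bL.
  have bpL : beta ^+ p \in L by rewrite beta_root.
  have [zp z1 wz] := kummer_conj beta0 betaM bpL gG gb.
  have zM : g beta / beta \in M by apply: memvM; rewrite ?memv_gal ?memvV.
  have [_ c0] := root_unity_level zM zp z1.
  have d0 : 0 < (p * c)%N%:Z - i%:Z by rewrite i0 subr0 ltz_nat muln_gt0 p0.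
  split=> //; apply: (break_of_generator betaM beta0 wbeta pm _ gG gb _ d0).
    exact: (degX beta x).
  by rewrite wz mulrA -PoszM i0 subr0.
case: x_level => _ [i00|[a0 [y [ha0 [yL y0] ex]]]]; first by rewrite i00 in i0.
have [ha0L ha0v] := (pidealE _ _ uu).1 ha0.
have a0L : a0 \in L by rewrite -(subrK 1 a0) memvD ?mem1v.
have a0i : vge w 1 (a0 - 1).
  by apply: vge_le ha0v; rewrite -gtz0_ge1 mulr_gt0 // ltz_nat.
have [a00 wa0] := valuation1_unit w_val a0i.
pose alpha := beta / y.
have alpha0 : alpha != 0 by rewrite mulf_neq0 ?invr_eq0.
have alphaM : alpha \in M by apply: memvM => //; rewrite memvV (subvP LM).
have alphap : alpha ^+ p = a0 by rewrite expr_div_n beta_root ex mulfK // expf_neq0.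
have notinL a : a != 0 -> a \in M -> a ^+ p = a0 -> a \notin L.
  by move=> an0 aM ea; apply: kummer_root_notin => //; exists y; rewrite ?ea.
have aL := notinL _ alpha0 alphaM alphap.
have [g gG ga] := moved_by_galois alphaM aL.
have apL : alpha ^+ p \in L by rewrite alphap.
have [zp z1 wz] := kummer_conj alpha0 alphaM apL gG ga.
set z := g alpha / alpha in zp z1 wz.
have zM : z \in M by apply: memvM; rewrite ?memv_gal ?memvV.
have [_ c0] := root_unity_level zM zp z1.
set lam := c%:Z * w u in wz.
have zi : vge w 0 z by have [_ wz0] := root_unity_val w_val p_prime zp; rewrite vge_val ?wz0.
have zj j : vge w lam (z ^+ j - 1) by apply: vge_subX1 => //; rewrite -wz vge_val.
have a01 : a0 - 1 != 0.
  rewrite subr_eq0; apply/eqP => a1; apply: x_npow; exists y => //.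
  by rewrite ex a1 mul1r.
have wa : w (a0 - 1) = i%:Z * w u.
  have [m wm] := uniformizer_dvd w_val uu ha0L a01.
  move: ha0v; rewrite vgeE // wm ler_pM2r // le_eqVlt => /orP[/eqP->//|lt].
  case: x_nlevel; apply: (u_succ i a0) => //; last by exists y.
  by rewrite vgeE // wm lezD1 ltr_pM2r.
(* The factors differ from [alpha - 1] by [z ^+ j - 1], of valuation at least [lam], and their
   valuations add up to [i * w u]. *)
have prod_alpha : \prod_(0 <= j < p) (alpha - z ^+ j) = a0 - 1.
  by rewrite (prod_subX_root p_prime) // alphap.
have alpha_neq j : alpha - z ^+ j != 0.
  apply: contraNneq a01 => h; rewrite -alphap.
  have -> : alpha = z ^+ j by apply/eqP; rewrite -subr_eq0 h.
  by rewrite -exprM mulnC exprM zp expr1n subrr.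
have nz : {in index_iota 0 p, forall j, alpha - z ^+ j != 0} by [].
have sum_alpha : \sum_(0 <= j < p) w (alpha - z ^+ j) = i%:Z * w u.
  by rewrite -wa -prod_alpha (valuation_prod w_val nz).
have sum_const (A : int) : \sum_(0 <= j < p) A = p%:Z * A.
  by rewrite big_const_nat iter_addr_0 subn0 -mulr_natl natz.
(* If [i > p * c], some factor has valuation above [lam], so a root [a] of [X^p - a0] is closer to 1
   than [lam]. So are its conjugates, yet distinct conjugates differ by valuation exactly [lam]. *)
have i_le : (i <= p * c)%N.
  rewrite leqNgt; apply/negP => lt.
  have [j jp lej] : exists2 j, (j < p)%N & lam < w (alpha - z ^+ j).
    apply: NNPP => no; have : i%:Z * w u <= p%:Z * lam.
      rewrite -sum_alpha -sum_const [X in X <= _]big_nat [X in _ <= X]big_nat.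
      apply: ler_sum => j /andP[_ jp]; rewrite leNgt; apply/negP => h; apply: no; by exists j.
    by rewrite /lam mulrA -PoszM ler_pM2r // lez_nat leqNgt lt.
  have zj0 : z ^+ j != 0 by rewrite expf_neq0 //; have [] := root_unity_val w_val p_prime zp.
  have wzj : w (z ^+ j) = 0.
    have [z0 wz0] := root_unity_val w_val p_prime zp; by rewrite valuationX // wz0 mulr0.
  pose a := alpha / z ^+ j.
  have an0 : a != 0 by rewrite mulf_neq0 ?invr_eq0.
  have aM : a \in M by apply: memvM; rewrite ?memvV ?rpredX.
  have eap : a ^+ p = a0 by rewrite expr_div_n alphap -exprM mulnC exprM zp expr1n divr1.
  have a1 : vge w (lam + 1) (a - 1).
    rewrite -(@vge_pmul _ _ w_val _ (z ^+ j)) // wzj add0r mulrBr mulr1 mulrC divfK //.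
    by rewrite vge_val // lezD1.
  have [h hG ha] := moved_by_galois aM (notinL _ an0 aM eap).
  have apL' : a ^+ p \in L by rewrite eap.
  have [_ _ wh] := kummer_conj an0 aM apL' hG ha.
  have wan : w a = 0.
    apply/eqP; have := valuationX w_val p an0; rewrite eap wa0 => /esym/eqP.
    by rewrite mulf_eq0 (negbTE pz0).
  have : vge w (lam + 1) (h a - a).
    have -> : h a - a = h (a - 1) - (a - 1) by rewrite rmorphB rmorph1 /=; ring.
    by apply: vgeB => //; rewrite /vge w_aut fmorph_eq0.
  have -> : h a - a = a * (h a / a - 1) by rewrite mulrBr mulr1 mulrC divfK.
  rewrite vgeE; last by rewrite mulf_neq0 // subr_eq0; apply: contra ha => /eqP e1; rewrite -(divfK an0 (h a)) e1 mul1r.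
  rewrite (Defs.valM w_val) //; last by rewrite subr_eq0; apply: contra ha => /eqP e1; rewrite -(divfK an0 (h a)) e1 mul1r.
  by rewrite wan wh add0r -/lam gerDl ler10.
pose b := alpha - 1; have b0 : b != 0 by have := alpha_neq 0%N; rewrite expr0.
have bM : b \in M by rewrite memvB ?mem1v.
(* If [w b < lam], every factor has valuation [w b]. If [w b > lam], the sum exceeds [p * lam],
   against [i_le]. If they are equal, [i_le] gives one inequality and the product the other. *)
have pwb : p%:Z * w b = i%:Z * w u.
  have ebz j : alpha - z ^+ j = b - (z ^+ j - 1) by rewrite /b; ring.
  have [lt|lt|eq] := ltgtP (w b) lam.
  - rewrite -sum_alpha -sum_const; apply: eq_big_nat => j _; apply/esym.
    rewrite ebz; have [] // := valuationD_small w_val (y := - (z ^+ j - 1)) b0.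
    by rewrite vgeN //; apply: vge_le (zj j); rewrite lezD1.
  - have : p%:Z * lam < i%:Z * w u.
      rewrite -sum_alpha -sum_const [X in X < _](big_ltn p0) [X in _ < X](big_ltn p0).
      rewrite expr0; apply: ltr_leD => //.
      rewrite [X in X <= _]big_nat [X in _ <= X]big_nat.
      apply: ler_sum => j _; rewrite -vgeE // ebz; apply: vgeB => //.
      by rewrite vge_val // ltW.
    by rewrite /lam mulrA -PoszM ltr_pM2r // ltz_nat ltnNge i_le.
  - apply/eqP; rewrite eq_le; apply/andP; split; last first.
      by rewrite eq /lam mulrA -PoszM ler_pM2r // lez_nat.
    rewrite -sum_alpha -sum_const [X in X <= _]big_nat [X in _ <= X]big_nat.
    apply: ler_sum => j _; rewrite -vgeE // ebz; apply: vgeB => //; first exact: vge_val.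
    by rewrite eq.
have wb_lam : w b <= lam.
  rewrite -(@ler_pM2l _ p%:Z) ?ltz_nat // pwb /lam mulrA -PoszM ler_pM2r //.
have wb0 : 0 < w b.
  by rewrite -(@pmulr_rgt0 _ p%:Z) ?ltz_nat // pwb mulr_gt0 // ltz_nat.
(* Otherwise some [l] in [L] approximates [b]. Dividing [alpha] by [1 + l] raises the valuation of
   the factor at [j = 0] above [w b], and the other [p - 1] keep at least [w b]; so [x] reaches step
   [i + 1]. *)
have pi : ~~ (p%:Z %| i%:Z)%Z.
  apply/negP => /dvdzP[i' ei].
  have [l lL hl] : exists2 l, l \in L & vge w (w b + 1) (b - l).
    by apply: (@approximate_in_L _ i') => //; rewrite pwb ei [i' * _]mulrC.
  have [l0 wl] := approximant_neq0 b0 hl.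
  have l1 : vge w 1 ((1 + l) - 1).
    by rewrite addrC addKr vge_val // wl -gtz0_ge1.
  have [ln0 wln] := valuation1_unit w_val l1.
  have lL1 : 1 + l \in L by rewrite memvD ?mem1v.
  pose a := alpha / (1 + l).
  have a1 : vge w (w b + 1) (a - 1).
    rewrite -(@vge_pmul _ _ w_val _ (1 + l)) // wln add0r mulrBr mulr1 mulrC divfK //.
    by rewrite opprD addrA.
  apply: x_nlevel; apply: (u_succ i (a ^+ p)).
  - by rewrite expr_div_n alphap memvM ?memvV ?rpredX.
  - rewrite -(prod_subX_root p_prime a zp z1) big_ltn // expr0.
    have -> : i%:Z * w u + 1 = (w b + 1) + p.-1%:Z * w b.
      by rewrite -pwb -{1}(prednK p0) intS; ring.
    apply: vgeM => //; have := @vge_prod_le _ w _ (index_iota 1 p) (fun j => a - z ^+ j) (w b) w_val.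
    rewrite size_iota subn1; apply=> j.
    have -> : a - z ^+ j = (a - 1) - (z ^+ j - 1) by ring.
    by apply: vgeB => //; [apply: vge_le a1; rewrite lerDl | apply: vge_le (zj j)].
  - exists ((1 + l) * y); first by split; rewrite ?mulf_neq0 ?memvM.
    by rewrite -exprMn mulrA divfK // exprMn alphap.
have i_lt : (i < p * c)%N.
  rewrite ltn_neqAle i_le andbT; apply: contra pi => /eqP->.
  by apply/dvdzP; exists c%:Z; rewrite -PoszM mulnC.
have d0 : 0 < (p * c)%N%:Z - i%:Z by rewrite subr_gt0 ltz_nat.
have gbb : g b - b = alpha * (z - 1).
  by rewrite /b rmorphB rmorph1 /= mulrBr mulr1 [alpha * z]mulrC divfK //; ring.
have gb : g b != b.
  by rewrite -subr_eq0 gbb mulf_neq0 // subr_eq0.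
split=> //; apply: (break_of_generator bM b0 pwb pi _ gG gb _ d0).
  pose P := ('X - (- 1)%:P) ^+ p - a0%:P : {poly N}.
  have sP : size P = p.+1.
    rewrite size_polyDl size_exp_XsubC // size_polyN size_polyC.
    by apply: leq_ltn_trans (leq_b1 _) _; rewrite ltnS.
  rewrite -ltnS -sP; apply: adjoin_degree_le.
  - by rewrite rpredB ?rpredX ?polyOverXsubC ?polyOverC ?rpredN ?mem1v.
  - by rewrite -size_poly_eq0 sP.
  - by rewrite rootE !hornerE /b opprK subrK alphap subrr.
(* [alpha] is a unit, so this has valuation [c * w u - w b]; times [p] it is [(p * c - i) * w u]. *)
have -> : g b / b - 1 = alpha * (z - 1) / b by rewrite -gbb mulrBl divff.
have walpha : w alpha = 0.
  apply/eqP; have := valuationX w_val p alpha0; rewrite alphap wa0 => /esym/eqP.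
  by rewrite mulf_eq0 (negbTE pz0).
have zn0 : z - 1 != 0 by rewrite subr_eq0.
rewrite (Defs.valM w_val) ?mulf_neq0 ?invr_eq0 // (Defs.valM w_val) // valuationV //.
rewrite walpha wz add0r mulrBr pwb /lam mulrA -PoszM -mulrBl.
by [].
Qed.

End Kummer.

Section ArtinSchreier.
Hypothesis p_char : p \in [pchar N].
Variables (x beta : N) (i : int).
Hypothesis x_nwp : ~ wp_image p L x.
Hypothesis betaM : beta \in M.
Hypothesis beta_root : beta ^+ p - beta = x.
Hypothesis x_level : in_pbar w p L i x.
Hypothesis x_nlevel : ~ in_pbar w p L (i + 1) x.

Lemma wpD (a b : N) : (a + b) ^+ p - (a + b) = (a ^+ p - a) + (b ^+ p - b).
Proof.
have := pFrobenius_autD_comm p_char (mulrC a b); rewrite !pFrobenius_autE => ->.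
by ring.
Qed.

Lemma wpN (a : N) : (- a) ^+ p - (- a) = - (a ^+ p - a).
Proof.
have := wpD a (- a); rewrite subrr expr0n gtn_eqF // subrr.
by move/esym/eqP; rewrite addrC addr_eq0 => /eqP.
Qed.

Lemma wpB (a b : N) : (a - b) ^+ p - (a - b) = (a ^+ p - a) - (b ^+ p - b).
Proof. by rewrite wpD wpN. Qed.

Lemma wp_root_val (a : N) : a != 0 -> a ^+ p - a = 0 -> w a = 0.
Proof.
move=> a0 /eqP; rewrite subr_eq0 => /eqP ea.
have := valuationX w_val p a0; rewrite ea => h.
have : (p%:Z - 1) * w a = 0 by rewrite mulrBl mul1r -h subrr.
by move/eqP; rewrite mulf_eq0 subr_eq0 (eqz_nat p 1) gtn_eqF // => /eqP.
Qed.

(** [g] translates [alpha] by a nonzero root [k] of [X^p - X], a unit. Hence [g alpha / alpha - 1]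
    has valuation [- w alpha], and [p * w alpha] is [i * w u] once [alpha] is known to have a
    pole. *)
Lemma artin_schreier_break : gamma = - i /\ 0 < gamma.
Proof.
have [z0 [_ [hz [y yL ->] ex]]] := x_level.
have [z0L hzv] := (pidealE _ _ uu).1 hz.
have wp_succ (a b : N) (j : int) : a \in L -> b \in L -> vge w (j * w u + 1) a ->
    x = a + (b ^+ p - b) -> in_pbar w p L (j + 1) x.
  move=> aL bL ha ->; exists a, (b ^+ p - b); split=> //; last by exists b.
  by apply/(pidealE _ _ uu); split=> //; apply: vge_uniformizer_succ.
pose alpha := beta - y.
have alphaM : alpha \in M by rewrite memvB // (subvP LM).
have alpha_wp : alpha ^+ p - alpha = z0 by rewrite wpB beta_root ex addrK.
have notinL a : a ^+ p - a = z0 -> a \notin L.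
  move=> ea; apply/negP => aL; apply: x_nwp; exists (a + y); first by rewrite memvD.
  by rewrite wpD ea.
have aL := notinL _ alpha_wp.
have [g gG ga] := moved_by_galois alphaM aL.
pose k := g alpha - alpha.
have k0 : k != 0 by rewrite subr_eq0.
have wk : w k = 0.
  apply: wp_root_val => //; rewrite wpB -rmorphXn -rmorphB /= alpha_wp.
  by rewrite (fixed_gal LM gG) // subrr.
have alpha0 : alpha != 0 by apply: contraNneq aL => ->; apply: mem0v.
have z00 : z0 != 0.
  apply/eqP => e; apply: x_nwp; exists y => //.
  by rewrite ex e add0r.
have wz : w z0 = i * w u.
  have [m wm] := uniformizer_dvd w_val uu z0L z00.
  move: hzv; rewrite vgeE // wm ler_pM2r // le_eqVlt => /orP[/eqP->//|lt].
  case: x_nlevel; apply: (wp_succ z0 y) => //.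
  by rewrite vgeE // wm lezD1 ltr_pM2r.
(* An integral [alpha] would be congruent to an element of [L], which [g] fixes; then [k] would lie
   in the maximal ideal. *)
have neg_alpha : w alpha < 0.
  rewrite ltNge; apply/negP => ge0.
  have [l lL hl] : exists2 l, l \in L & vge w 1 (alpha - l).
    have [e|ne] := eqVneq (w alpha) 0.
      have [|l lL hl] := @approximate_in_L alpha 0 alphaM alpha0.
        by rewrite e !mulr0 mul0r.
      by exists l => //; rewrite e add0r in hl.
    by exists 0; rewrite ?mem0v // subr0 vge_val // -gtz0_ge1 lt_neqAle eq_sym ne.
  have : vge w 1 k.
    have -> : k = g (alpha - l) - (alpha - l).
      by rewrite rmorphB /= (fixed_gal LM gG lL) /k; ring.
    by apply: vgeB => //; rewrite /vge w_aut fmorph_eq0.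
  by rewrite vgeE // wk.
have alp0 : alpha ^+ p != 0 by rewrite expf_neq0.
have lt_walpha : p%:Z * w alpha < w alpha.
  by rewrite -subr_gt0 -[X in X - _]mul1r -mulrBl nmulr_lgt0 // subr_lt0 ltz_nat.
have wpalpha : p%:Z * w alpha = i * w u.
  rewrite -wz -alpha_wp -(valuationX w_val p alpha0).
  have [] // := valuationD_small w_val (y := - alpha) alp0.
  by rewrite vgeN // vge_val // lezD1 valuationX.
have i_neg : i < 0.
  by rewrite -(@pmulr_llt0 _ (w u)) // -wpalpha pmulr_rlt0 // ltz_nat.
(* Otherwise some [l] in [L] has the leading term of [alpha], and subtracting [l ^+ p - l] from [z0]
   moves [x] into step [i + 1]. *)
have pi : ~~ (p%:Z %| i)%Z.
  apply/negP => /dvdzP[i' ei].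
  have [l lL hl] : exists2 l, l \in L & vge w (w alpha + 1) (alpha - l).
    by apply: (@approximate_in_L _ i') => //; rewrite wpalpha ei [i' * _]mulrC.
  apply: x_nlevel; apply: (wp_succ (z0 - (l ^+ p - l)) (y + l)).
  - by rewrite !memvB ?rpredX.
  - by rewrite memvD.
  - rewrite -alpha_wp -wpB -wpalpha; apply: vgeB => //.
      have [->|al0] := eqVneq (alpha - l) 0; first by rewrite expr0n gtn_eqF // vge0.
      move: hl; rewrite !vgeE ?expf_neq0 // valuationX // lezD1 => hl.
      by rewrite lezD1 ltr_pM2l // ltz_nat.
    by apply: vge_le hl; rewrite lerD2r ltW.
  - by rewrite ex wpD; ring.
have d0 : 0 < - i by rewrite oppr_gt0.
suff e : gamma = - i by rewrite e.
apply: (break_of_generator alphaM alpha0 wpalpha pi _ gG ga _ d0).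
  pose P := 'X^p - ('X + z0%:P) : {poly N}.
  have sP : size P = p.+1.
    by rewrite size_polyDl size_polyXn // size_polyN size_XaddC.
  rewrite -ltnS -sP; apply: adjoin_degree_le.
  - by rewrite rpredB ?rpredD ?polyOverXn ?polyOverX ?polyOverC.
  - by rewrite -size_poly_eq0 sP.
  - by rewrite rootE !hornerE -alpha_wp; apply/eqP; ring.
have -> : g alpha / alpha - 1 = k / alpha by rewrite mulrBl divff.
rewrite (Defs.valM w_val) ?invr_eq0 // valuationV // wk add0r mulrN wpalpha.
by rewrite mulNr.
Qed.

End ArtinSchreier.

End KummerArtinSchreier.

(** * Break, level and differental excess of [E] *)

Theorem mainTheorem2
  (p : nat) (p_prime : prime p)
  (K : fieldType) (v : K -> int) (K_pfield : p_field p v)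
  (N : splittingFieldType K) (N_galois : galois 1%AS {:N}%AS)
  (w : N -> int) (w_val : normalized_valuation w)
  (w_ext : extends_valuation v w)
  (E : {subfield N}) (E_wild : wildly_primitive w p E)
  (n : nat) (E_deg : \dim E = (p ^ n)%N)
  (zeta : N) (zeta_prim : (p ^ n - 1)%N.-primitive_root zeta)
  (Kn Ln M : {subfield N})
  (Kn_def : Kn = <<1; zeta>>%AS)
  (Ln_def : adjoin_all_radicals (p ^ n - 1) Kn Ln)
  (M_def : M = (E * Ln)%AS)
  (gamma : int) (gamma_break : ramification_break w M Ln gamma)
  (D : N -> Prop) (delta : int)
  (D_level :
     [/\ [pchar K] =i pred0, simple_mul_submodule p n Ln D,
         adjoin_radicals p Ln D M & mul_level w p Ln D delta] \/
     [/\ p \in [pchar K], simple_add_submodule p n Ln D,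
         adjoin_wp_roots p Ln D M & add_level w p Ln D delta])
  (eps : int) (E_excess : differental_excess v w E eps) :
  gamma = delta /\ delta = eps.
Proof.
have p0 := prime_gt0 p_prime; have p1 := prime_gt1 p_prime.
have n0 : (0 < n)%N.
  have [[E1 _] _ _] := E_wild; rewrite lt0n; apply: contraTneq E1 => n0.
  by rewrite E_deg n0.
(* One factor [p] of the degree of [M] over [Ln] is the degree of the subextension [Ln(b)]; [p ^ m]
   remains above it. *)
have [m en] : exists m, n = m.+1 by exists n.-1; rewrite prednK.
set e := (p ^ n - 1)%N in zeta_prim Ln_def.
have e1 : e.+1 = (p ^ n)%N by rewrite /e subn1 prednK // expn_gt0 p0.
have pq : (p ^ n)%N = (p * p ^ m)%N by rewrite en expnS.
have pe : ~~ (p %| e)%N.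
  apply/negP => h; have : (p %| e.+1)%N by rewrite e1 pq dvdn_mulr.
  by rewrite -addn1 dvdn_addr // dvdn1 => /eqP ep; rewrite ep in p1.
have cop : coprime p.-1 (p * p ^ m)%N.
  by rewrite -expnS coprimeXr // -{2}(prednK p0) coprimenS.
have zeta_root := prim_expr_order zeta_prim.
have [s us] := field_uniformizer p_prime K_pfield N_galois w_ext 1%AS.
have [t ut] := field_uniformizer p_prime K_pfield N_galois w_ext E.
have [w_s E_gen] := wild_totally_ramified p_prime K_pfield N_galois w_val w_ext E_wild E_deg us ut.
rewrite -e1 in w_s E_deg; rewrite Kn_def in Ln_def.
have [u uL us_e] := tame_uniformizer_root pe us Ln_def.
have w_u := compositum_val_u w_val pe us ut us_e w_s.
have uM := compositum_uniformizer p_prime K_pfield N_galois w_val w_ext pe us ut zeta_root Ln_def uL us_e w_s.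
have uuL := compositum_L_uniformizer p_prime K_pfield N_galois w_val w_ext pe us zeta_root Ln_def uL us_e.
have [M_gen M_deg _] := compositum_structure p_prime K_pfield N_galois w_val w_ext pe us ut zeta_root Ln_def uL us_e E_gen E_deg w_s.
have w_aut := val_aut (pfield_complete K_pfield) w_val w_ext.
have w_p := vge_p K_pfield w_ext.
have q'0 : (0 < p ^ m)%N by rewrite expn_gt0 p0.
rewrite M_def in gamma_break D_level.
have {}M_galois : galois Ln (E * Ln)%AS.
  case: D_level => [[_ [[[DL _ _ _ _] _ _] _] M_roots _]|[_ [[[DL _ _ _ _] _ _] _] M_roots _]];
    apply: (adjoin_roots_galois N_galois M_roots) => _ [x /DL xL ->].
  - by have [xL' _] := xL; rewrite rpredB ?polyOverXn ?polyOverC.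
  - by rewrite !rpredB ?polyOverXn ?polyOverX ?polyOverC.
(* Positivity of [gamma] is extracted together with its value, because the valuation of [f'(t)]
   below depends on it. *)
have [e_gd gamma0] : gamma = delta /\ 0 < gamma.
  move: w_u M_deg; rewrite e1 pq => w_u M_deg.
  case: D_level => [[K0 [[[DL _ _ _ _] [x Dx x_npow] _] _] M_roots lev]|[Kp [[[DL _ _ _ _] [x Dx x_nwp] _] _] M_roots lev]].
    have [e' [i [eabs lev_i lev_Si ->]]] := lev.
    have pn0 : p%:R != 0 :> N.
      rewrite -(rmorph_nat (in_alg N)) fmorph_eq0; apply/negP => pK.
      by have := K0 p; rewrite !inE p_prime pK.
    have [||beta betaM] := adjoin_roots_root (q := 'X^p - x%:P) M_roots.
    - by exists x.
    - by rewrite size_XnsubC.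
    rewrite root_XnsubC => /eqP beta_root.
    apply: (kummer_break w_val w_aut p_prime w_p q'0 cop uuL uM w_u M_gen M_deg M_galois
      gamma_break pn0 eabs (DL x Dx) x_npow betaM beta_root (lev_i x Dx)).
    by move=> /(lev_Si x Dx).
  have [i [lev_i lev_Si ->]] := lev.
  have p_char : p \in [pchar N] by rewrite (fmorph_pchar (in_alg N)) in Kp *.
  have [||beta betaM] := adjoin_roots_root (q := 'X^p - 'X - x%:P) M_roots.
  - by exists x.
  - by rewrite -addrA -opprD size_polyDl size_polyXn // size_polyN size_XaddC.
  rewrite rootE !hornerE subr_eq0 => /eqP beta_root.
  apply: (artin_schreier_break w_val w_aut p_prime w_p q'0 uuL uM w_u M_gen M_deg M_galois
    gamma_break p_char x_nwp betaM beta_root (lev_i x Dx)).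
  by move=> /(lev_Si x Dx).
split=> //; rewrite -e_gd.
have [D0 wD] := different_val_t p_prime K_pfield N_galois w_val w_ext pe us ut zeta_root
  Ln_def uL us_e E_gen E_deg w_s M_galois gamma_break gamma0.
have deg1 : adjoin_degree 1%AS t = e.+1.
  by have := dim_Fadjoin 1%AS t; rewrite E_gen E_deg dimv1 muln1.
have [d [r [diff [s' [t' [us' ut' ram]]] ->]]] := E_excess.
have wt : w t != 0 by apply: lt0r_neq0; case: ut.
have er : r%:Z = e.+1%:Z.
  apply: (mulIf wt); rewrite -w_s (uniformizer_val us us') ram.
  by rewrite (uniformizer_val ut ut').
have w_s' : w s = (adjoin_degree 1%AS t)%:Z * w t by rewrite deg1.
have := different_exponent_gen w_val w_ext E_gen us ut w_s' D0 diff.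
(* Here [d = e + gamma] and [r = e + 1], so [d - (r - 1)] is [gamma]. *)
rewrite wD => /(mulIf wt) ed; rewrite -ed er intS.
by ring.
Qed.
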